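(* Let $n\ge 1$. For any $d\ge 1$ there is an isomorphism of $\mathrm{GL}(V_n)$-modules $$B_{d,0}(n)\cong\bigoplus_{\lambda\vdash d}V_{2\lambda},$$ where $2\lambda=(2\lambda_1,\dots,2\lambda_r)\vdash 2d$ for $\lambda=(\lambda_1,\dots,\lambda_r)\vdash d$. For any $d\ge 2$ there is an isomorphism of $\mathrm{GL}(V_n)$-modules $$B_{d,1}(n)\cong\bigoplus_{\lambda}V_{\lambda},$$ where $\lambda$ runs over all partitions of $2d-1$ with exactly $3$ odd parts.
   Context: $\mathbb K$ is a field of characteristic $0$ and $V_n$ is an $n$-dimensional $\mathbb K$-vector space. $B_{d,k}(n)$ is the $\mathbb K$-vector space spanned by open Jacobi diagrams (finite uni-trivalent graphs with a cyclic order on the half-edges at each trivalent vertex, each connected component having at least one univalent vertex) of degree $d$ (half the number of vertices) with exactly $k$ trivalent vertices, whose univalent vertices are colored by elements of $V_n$, modulo the AS and IHX relations and multilinearity in the colors. $\mathrm{GL}(V_n)$ acts by acting on all colors. For a partition $\lambda$, $V_\lambda=\mathbb S_\lambda V_n$ is the image of $V_n$ under the Schur functor $\mathbb S_\lambda$ (it is $0$ if $\lambda$ has more than $n$ rows), normalized so that $V_{(m)}=\mathrm{Sym}^m V_n$. *)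

(* Defs.v *)
From HB Require Import structures.
From mathcomp Require Import all_boot all_order all_fingroup all_algebra.
From mathcomp Require Import finmap boolp.
From mathcomp.multinomials Require Import monalg.

Set Implicit Arguments.
Unset Strict Implicit.
Unset Printing Implicit Defensive.

Import GRing.Theory.
Local Open Scope ring_scope.

(* Free modules {malg K[X]} : the unique linear extension of h : X -> M.      *)
Section FreeLift.
Variables (K : fieldType) (X : choiceType) (M : lmodType K).

Definition free_lift (h : X -> M) (g : {malg K[X]}) : M :=
  \sum_(x <- msupp g) g@_x *: h x.

Lemma free_liftw h (d : {fset X}) g : (fsubset (msupp g) d) ->
  free_lift h g = \sum_(x <- d) g@_x *: h x.
Proof.
move=> le_gd; rewrite /free_lift; apply: big_fset_incl => // x _.
by rewrite -mcoeff_eq0 => /eqP ->; rewrite scale0r.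
Qed.

Lemma free_lift_linear h : linear (free_lift h).
Proof.
move=> a f g.
pose d := fsetU (fsetU (msupp f) (msupp g)) (msupp (a *: f + g)).
rewrite !(@free_liftw h d) ?fsubsetUr //; last first.
- by apply: fsubset_trans (fsubsetUl _ _); rewrite fsubsetUl.
- by apply: fsubset_trans (fsubsetUl _ _); rewrite fsubsetUr.
rewrite scaler_sumr -big_split /=; apply: eq_bigr => x _.
by rewrite mcoeffD mcoeffZ scalerDl scalerA.
Qed.

HB.instance Definition _ h := GRing.isLinear.Build K {malg K[X]} M _
  (free_lift h) (free_lift_linear h).

Lemma free_liftU h x : free_lift h << x >> = h x.
Proof.
by rewrite /free_lift msuppU oner_eq0 big_seq_fset1 mcoeffUU scale1r.
Qed.

Lemma free_lift_rel h a x y z :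
  free_lift h (<< x >> - (a *: << y >> + << z >>)) = h x - (a *: h y + h z).
Proof. by rewrite linearB linearP /= !free_liftU. Qed.

Lemma free_liftUB h x y : free_lift h (<< x >> - << y >>) = h x - h y.
Proof. by rewrite linearB /= !free_liftU. Qed.

Lemma free_liftUD h x y : free_lift h (<< x >> + << y >>) = h x + h y.
Proof. by rewrite linearD /= !free_liftU. Qed.

Lemma free_liftUDD h x y z :
  free_lift h (<< x >> + << y >> + << z >>) = h x + h y + h z.
Proof. by rewrite !linearD /= !free_liftU. Qed.

Lemma free_lift_unique (f : {linear {malg K[X]} -> M}) h :
  (forall x, f << x >> = h x) -> f =1 free_lift h.
Proof.
move=> fh g; rewrite {1}[g]monalgE linear_sum; apply: eq_bigr => x _.
have -> : << g@_x *g x >> = g@_x *: << x >> :> {malg K[X]}.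
  by apply/malgP=> y; rewrite mcoeffZ !mcoeffU mulrnAr mulr1.
by rewrite linearZ /= fh.
Qed.
End FreeLift.

(* Quotient of a module by the submodule spanned by a set R of relators.      *)
Section LinearQuotient.
Variables (K : fieldType) (F : lmodType K) (R : F -> Prop).

Definition lspan : pred F := fun x => `[< exists s : seq (K * F),
  (forall p, p \in s -> R p.2) /\ x = \sum_(p <- s) p.1 *: p.2 >].

Lemma lspan_submod : submod_closed lspan.
Proof.
split=> [|a x y /asboolP[s [sR ->]] /asboolP[t [tR ->]]]; apply/asboolP.
  by exists [::]; rewrite big_nil.
exists ([seq (a * p.1, p.2) | p <- s] ++ t); split.
  move=> p; rewrite mem_cat => /orP[/mapP[q qs ->] /=|]; [exact: sR|exact: tR].
rewrite big_cat big_map /= scaler_sumr; congr (_ + _).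
by apply: eq_bigr => p _; rewrite scalerA.
Qed.

HB.instance Definition _ := GRing.isSubmodClosed.Build K F lspan lspan_submod.

Lemma lspan_gen x : R x -> x \in lspan.
Proof.
move=> Rx; apply/asboolP; exists [:: (1, x)]; split.
  by move=> p; rewrite inE => /eqP ->.
by rewrite big_seq1 scale1r.
Qed.

Definition lspan_zmod : zmodClosed F := GRing.ZmodClosed.clone F lspan _.
Definition lquot := Quotient.quot lspan_zmod.
HB.instance Definition _ := GRing.Zmodule.on lquot.

Definition lproj (x : F) : lquot := (\pi_lquot x)%qT.
Definition lrepr (x : lquot) : F := generic_quotient.repr x.

Lemma lreprK : cancel lrepr lproj.
Proof. by move=> x; rewrite /lproj /lrepr reprK. Qed.

Lemma lproj_eq x y : lproj x = lproj y <-> x - y \in lspan.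
Proof.
by rewrite Quotient.idealrBE; split=> [?|/eqP]; [apply/eqP|].
Qed.

Lemma lprojB : {morph lproj : x y / x - y}.
Proof. by move=> x y; rewrite /lproj !piE. Qed.

Lemma lprojD : {morph lproj : x y / x + y}.
Proof. by move=> x y; rewrite /lproj !piE. Qed.

Definition lquot_scale a (x : lquot) : lquot := lproj (a *: lrepr x).

Lemma lquot_scaleE a x : lquot_scale a (lproj x) = lproj (a *: x).
Proof.
apply/lproj_eq; rewrite -scalerBr; apply: rpredZ.
by apply/lproj_eq; rewrite lreprK.
Qed.

Lemma lquot_scaleA a b x :
  lquot_scale a (lquot_scale b x) = lquot_scale (a * b) x.
Proof. by rewrite -[x]lreprK !lquot_scaleE scalerA. Qed.

Lemma lquot_scale1 : left_id 1 lquot_scale.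
Proof. by move=> x; rewrite -[x]lreprK lquot_scaleE scale1r. Qed.

Lemma lquot_scaleDr : right_distributive lquot_scale +%R.
Proof.
move=> a x y; rewrite -[x]lreprK -[y]lreprK.
by rewrite -lprojD !lquot_scaleE scalerDr lprojD.
Qed.

Lemma lquot_scaleDl x : {morph lquot_scale^~ x : a b / a + b}.
Proof.
by move=> a b; rewrite -[x]lreprK !lquot_scaleE scalerDl lprojD.
Qed.

HB.instance Definition _ := GRing.Zmodule_isLmodule.Build K lquot
  lquot_scaleA lquot_scale1 lquot_scaleDr lquot_scaleDl.

Lemma lproj_linear : linear lproj.
Proof. by move=> a x y; rewrite lprojD -lquot_scaleE. Qed.

HB.instance Definition _ := GRing.isLinear.Build K F lquot _ lproj lproj_linear.
End LinearQuotient.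

Section LinearQuotientMap.
Variables (K : fieldType) (F1 F2 : lmodType K).
Variables (R1 : F1 -> Prop) (R2 : F2 -> Prop) (f : {linear F1 -> F2}).

Definition lquot_map (x : lquot R1) : lquot R2 := lproj R2 (f (lrepr x)).

Hypothesis fR : forall r, R1 r -> f r \in lspan R2.

Lemma lquot_mapE x : lquot_map (lproj R1 x) = lproj R2 (f x).
Proof.
apply/lproj_eq; rewrite -linearB.
have /asboolP[s [sR ->]] : lrepr (lproj R1 x) - x \in lspan R1.
  by apply/lproj_eq; rewrite lreprK.
rewrite linear_sum big_seq; apply: rpred_sum => p ps.
by rewrite linearZ; apply: rpredZ; apply: fR; apply: sR.
Qed.

Lemma lquot_map_linear : linear lquot_map.
Proof.
move=> a x y; rewrite -[x]lreprK -[y]lreprK -linearP !lquot_mapE.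
by rewrite !linearP.
Qed.
End LinearQuotientMap.
Arguments lquot_map {K F1 F2} R1 R2 f x.

Section Representations.
Variables (K : fieldType) (G : groupType).

Record repMod := RepMod {
  rep_car :> lmodType K;
  rep_act : G -> rep_car -> rep_car;
  rep_act_linear : forall g, linear (rep_act g);
  rep_act1 : forall x, rep_act 1%g x = x;
  rep_actM : forall g h x, rep_act (g * h)%g x = rep_act g (rep_act h x)
}.

Definition rep_iso (M N : repMod) : Prop :=
  exists phi : {linear M -> N},
    bijective phi /\ forall g x, phi (rep_act g x) = rep_act g (phi x).
End Representations.

Section DirectSum.
Variables (K : fieldType) (I : finType).

Section Module.
Variable M : I -> lmodType K.

Definition dsum := {dffun forall i, M i}.
HB.instance Definition _ := Choice.on dsum.

Definition dsum0 : dsum := [ffun i => 0].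
Definition dsumN (f : dsum) : dsum := [ffun i => - f i].
Definition dsumD (f g : dsum) : dsum := [ffun i => f i + g i].
Definition dsumZ a (f : dsum) : dsum := [ffun i => a *: f i].

Fact dsumA : associative dsumD.
Proof. by move=> f g h; apply/ffunP=> i; rewrite !ffunE addrA. Qed.
Fact dsumC : commutative dsumD.
Proof. by move=> f g; apply/ffunP=> i; rewrite !ffunE addrC. Qed.
Fact dsum0D : left_id dsum0 dsumD.
Proof. by move=> f; apply/ffunP=> i; rewrite !ffunE add0r. Qed.
Fact dsumND : left_inverse dsum0 dsumN dsumD.
Proof. by move=> f; apply/ffunP=> i; rewrite !ffunE addNr. Qed.

HB.instance Definition _ := GRing.isZmodule.Build dsum dsumA dsumC dsum0D dsumND.

Fact dsumZA a b f : dsumZ a (dsumZ b f) = dsumZ (a * b) f.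
Proof. by apply/ffunP=> i; rewrite !ffunE scalerA. Qed.
Fact dsumZ1 : left_id 1 dsumZ.
Proof. by move=> f; apply/ffunP=> i; rewrite !ffunE scale1r. Qed.
Fact dsumZDr : right_distributive dsumZ +%R.
Proof. by move=> a f g; apply/ffunP=> i; rewrite !ffunE scalerDr. Qed.
Fact dsumZDl f : {morph dsumZ^~ f : a b / a + b}.
Proof. by move=> a b; apply/ffunP=> i; rewrite !ffunE scalerDl. Qed.

HB.instance Definition _ :=
  GRing.Zmodule_isLmodule.Build K dsum dsumZA dsumZ1 dsumZDr dsumZDl.
End Module.

Variables (G : groupType) (M : I -> repMod K G).

Definition dsum_act (g : G) (f : dsum M) : dsum M := [ffun i => rep_act g (f i)].

Fact dsum_act_linear g : linear (dsum_act g).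
Proof.
by move=> a f h; apply/ffunP=> i; rewrite !ffunE rep_act_linear.
Qed.
Fact dsum_act1 f : dsum_act 1%g f = f.
Proof. by apply/ffunP=> i; rewrite !ffunE rep_act1. Qed.
Fact dsum_actM g h f : dsum_act (g * h)%g f = dsum_act g (dsum_act h f).
Proof. by apply/ffunP=> i; rewrite !ffunE rep_actM. Qed.

Definition dsum_rep : repMod K G := RepMod dsum_act_linear dsum_act1 dsum_actM.
End DirectSum.

Notation "\repsum_ ( i : I ) M" := (@dsum_rep _ I _ (fun i : I => M))
  (at level 41, M at level 41, i at level 50, I at level 200,
   format "\repsum_ ( i  :  I )  M").

Section GeneralLinearGroup.
Variables (K : fieldType) (V : vectType K).

Record GL := MkGL { GL_val :> 'End(V); _ : lker GL_val == 0%VS }.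

HB.instance Definition _ := [isSub for GL_val].
HB.instance Definition _ := [Choice of GL by <:].

Lemma GLP (g : GL) : lker g == 0%VS. Proof. exact: valP g. Qed.

Fact GL1_subproof : lker (\1%VF : 'End(V)) == 0%VS.
Proof. by apply/lker0P=> x y; rewrite !id_lfunE. Qed.
Fact GLM_subproof (g h : GL) : lker (g \o h)%VF == 0%VS.
Proof.
apply/lker0P=> x y; rewrite !comp_lfunE => /(lker0P (GLP g)).
exact: (lker0P (GLP h)).
Qed.
Fact GLV_subproof (g : GL) : lker (g^-1)%VF == 0%VS.
Proof. by apply/lker0P; exact: can_inj (lker0_lfunVK (GLP g)). Qed.

Definition GL1 := MkGL GL1_subproof.
Definition GLM g h := MkGL (GLM_subproof g h).
Definition GLV g := MkGL (GLV_subproof g).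

Fact GLMA : associative GLM.
Proof. by move=> g h k; apply: val_inj; apply: comp_lfunA. Qed.
Fact GL1M : left_id GL1 GLM.
Proof. by move=> g; apply: val_inj; apply: comp_lfun1l. Qed.
Fact GLM1 : right_id GL1 GLM.
Proof. by move=> g; apply: val_inj; apply: comp_lfun1r. Qed.
Fact GLVM : left_inverse GL1 GLV GLM.
Proof. by move=> g; apply: val_inj; apply: lker0_compVf (GLP g). Qed.
Fact GLMV : right_inverse GL1 GLV GLM.
Proof. by move=> g; apply: val_inj; apply: lker0_compfV (GLP g). Qed.

HB.instance Definition _ := isGroup.Build GL GLMA GL1M GLM1 GLVM GLMV.

Lemma GL1E x : (1%g : GL) x = x. Proof. exact: id_lfunE. Qed.
Lemma GLME (g h : GL) x : (g * h)%g x = g (h x). Proof. exact: comp_lfunE. Qed.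
End GeneralLinearGroup.

(* Multilinearity relators: G c is a generator depending on a family          *)
(* c : I -> V that is to be made linear in each c i.                          *)
Section Multilinear.
Variables (K : fieldType) (V : lmodType K) (I : finType) (X : choiceType).

Definition update (c : {ffun I -> V}) (i : I) (x : V) : {ffun I -> V} :=
  [ffun j => if j == i then x else c j].

Definition multilinear_rel (G : {ffun I -> V} -> X) (r : {malg K[X]}) : Prop :=
  exists c i a x y,
    r = << G (update c i (a *: x + y)) >>
        - (a *: << G (update c i x) >> + << G (update c i y) >>).

Definition fmap (f : V -> V) (c : {ffun I -> V}) : {ffun I -> V} :=
  [ffun i => f (c i)].

Lemma fmap_update (f : V -> V) c i x :
  fmap f (update c i x) = update (fmap f c) i (f x).
Proof. by apply/ffunP=> j; rewrite !ffunE; case: eqP. Qed.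

Lemma fmap_id c : fmap id c = c.
Proof. by apply/ffunP=> j; rewrite ffunE. Qed.

Lemma fmap_comp f g c : fmap (f \o g) c = fmap f (fmap g c).
Proof. by apply/ffunP=> j; rewrite !ffunE. Qed.
End Multilinear.

(* The tensor power of V with factors indexed by the finite set I.            *)
Section TensorPower.
Variables (K : fieldType) (V : lmodType K) (I : finType).
Local Notation X := {ffun I -> V}.

Definition tensor_rel : {malg K[X]} -> Prop := multilinear_rel id.
Definition tensor := lquot tensor_rel.
HB.instance Definition _ := GRing.Lmodule.on tensor.

Definition pure_tensor (c : X) : tensor := lproj tensor_rel << c >>.

Definition tensor_map (f : V -> V) : tensor -> tensor :=
  lquot_map tensor_rel tensor_rel
    (free_lift (fun c : X => << fmap f c >> : {malg K[X]})).

Definition tensor_perm (s : {perm I}) : tensor -> tensor :=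
  lquot_map tensor_rel tensor_rel
    (free_lift (fun c : X => << [ffun i => c (s i)] >> : {malg K[X]})).

Lemma tensor_map_rel (f : {linear V -> V}) r : tensor_rel r ->
  free_lift (fun c : X => << fmap f c >> : {malg K[X]}) r \in lspan tensor_rel.
Proof.
move=> [c [i [a [x [y ->]]]]]; apply: lspan_gen.
exists (fmap f c), i, a, (f x), (f y).
by rewrite free_lift_rel !fmap_update linearP.
Qed.

Lemma tensor_perm_rel (s : {perm I}) r : tensor_rel r ->
  free_lift (fun c : X => << [ffun i => c (s i)] >> : {malg K[X]}) r
    \in lspan tensor_rel.
Proof.
move=> [c [i [a [x [y ->]]]]]; apply: lspan_gen.
exists [ffun j => c (s j)], (s^-1%g i), a, x, y.
have E z : [ffun j => update c i z (s j)]
    = update [ffun j => c (s j)] (s^-1%g i) z.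
  by apply/ffunP=> j; rewrite !ffunE (can2_eq (permK s) (permKV s)).
by rewrite free_lift_rel !E.
Qed.

Lemma tensor_map_linear (f : {linear V -> V}) : linear (tensor_map f).
Proof. exact/lquot_map_linear/tensor_map_rel. Qed.

Lemma tensor_perm_linear s : linear (tensor_perm s).
Proof. exact/lquot_map_linear/tensor_perm_rel. Qed.

HB.instance Definition _ (f : {linear V -> V}) :=
  GRing.isLinear.Build K tensor tensor _ (tensor_map f) (tensor_map_linear f).
HB.instance Definition _ s :=
  GRing.isLinear.Build K tensor tensor _ (tensor_perm s) (tensor_perm_linear s).

Lemma tensor_mapE (f : {linear V -> V}) c :
  tensor_map f (pure_tensor c) = pure_tensor (fmap f c).
Proof.
rewrite /tensor_map lquot_mapE /= ?free_liftU // => r.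
exact: tensor_map_rel.
Qed.

Lemma tensor_permE s c :
  tensor_perm s (pure_tensor c) = pure_tensor [ffun i => c (s i)].
Proof.
rewrite /tensor_perm lquot_mapE /= ?free_liftU // => r.
exact: tensor_perm_rel.
Qed.

Lemma tensor_ind (P : tensor -> Prop) :
  (forall a x y, P x -> P y -> P (a *: x + y)) -> P 0 ->
  (forall c, P (pure_tensor c)) -> forall t, P t.
Proof.
move=> PP P0 Pc t; rewrite -[t]lreprK [lrepr t]monalgE linear_sum.
apply: (big_ind P) => // [x y Px Py|c _].
  by rewrite -[x]scale1r; apply: PP.
have -> : << (lrepr t)@_c *g c >> = (lrepr t)@_c *: << c >> :> {malg K[X]}.
  by apply/malgP=> y; rewrite mcoeffZ !mcoeffU mulrnAr mulr1.
rewrite linearZ /= -[_ *: _]addr0; apply: PP => //.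
exact: Pc.
Qed.
End TensorPower.

(* The Schur functor S_l, for l : seq nat a partition: V^{(x) boxes of l}     *)
(* has one factor for each box of the Young diagram of l, and S_l(V) is the   *)
(* image of the Young symmetrizer c_l = a_l b_l, where a_l is the sum of the  *)
(* permutations preserving the rows and b_l is the signed sum of those        *)
(* preserving the columns. For l = [:: m] this is the space Sym^m V of        *)
(* symmetric tensors, and for l = nseq m 1 it is the exterior power.          *)
Section SchurFunctor.
Variables (K : fieldType).

Definition box (l : seq nat) := {i : 'I_(size l) & 'I_(nth 0%N l i)}.
HB.instance Definition _ l := Finite.on (box l).

Definition box_row l (b : box l) : nat := tag b.
Definition box_col l (b : box l) : nat := tagged b.

Definition row_perm l (s : {perm box l}) :=
  [forall b, box_row (s b) == box_row b].
Definition col_perm l (s : {perm box l}) :=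
  [forall b, box_col (s b) == box_col b].

Section Functor.
Variables (l : seq nat) (V : vectType K).

Definition young_symmetrizer (t : tensor V (box l)) : tensor V (box l) :=
  \sum_(s : {perm box l} | row_perm s)
    tensor_perm s
      (\sum_(u : {perm box l} | col_perm u) (-1) ^+ odd_perm u *: tensor_perm u t).

Lemma young_symmetrizer_linear : linear young_symmetrizer.
Proof.
move=> a x y; rewrite /young_symmetrizer scaler_sumr -big_split /=.
apply: eq_bigr => s _; rewrite -linearP; congr tensor_perm.
rewrite scaler_sumr -big_split /=; apply: eq_bigr => u _.
by rewrite linearP scalerDr !scalerA mulrC.
Qed.

HB.instance Definition _ := GRing.isLinear.Build K
  (tensor V (box l)) (tensor V (box l)) _ young_symmetrizer
  young_symmetrizer_linear.

Definition young_image : pred (tensor V (box l)) :=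
  fun t => `[< exists u, t = young_symmetrizer u >].

Fact young_image_submod : submod_closed young_image.
Proof.
split=> [|a x y /asboolP[u ->] /asboolP[v ->]]; apply/asboolP.
  by exists 0; rewrite linear0.
by exists (a *: u + v); rewrite linearP.
Qed.

HB.instance Definition _ :=
  GRing.isSubmodClosed.Build K (tensor V (box l)) young_image young_image_submod.

Record schur := MkSchur { schur_val :> tensor V (box l); _ : young_image schur_val }.

HB.instance Definition _ := [isSub for schur_val].
HB.instance Definition _ := [Choice of schur by <:].
HB.instance Definition _ := [SubChoice_isSubLmodule of schur by <:].

Lemma young_symmetrizer_map (f : {linear V -> V}) t :
  tensor_map f (young_symmetrizer t) = young_symmetrizer (tensor_map f t).
Proof.
have pm s u : tensor_map f (tensor_perm s u) = tensor_perm s (tensor_map f u).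
  elim/tensor_ind: u => [a x y Ex Ey||c].
  - by rewrite !linearP /= Ex Ey.
  - by rewrite !linear0.
  by rewrite tensor_permE !tensor_mapE tensor_permE; congr pure_tensor;
     apply/ffunP=> i; rewrite !ffunE.
rewrite linear_sum /=; apply: eq_bigr => s _; rewrite pm; congr tensor_perm.
by rewrite linear_sum /=; apply: eq_bigr => u _; rewrite linearZ /= pm.
Qed.

Fact schur_act_subproof (g : GL V) (t : schur) : young_image (tensor_map g t).
Proof.
case: t => t /= /asboolP[u ->]; apply/asboolP; exists (tensor_map g u).
exact: young_symmetrizer_map.
Qed.

Definition schur_act (g : GL V) (t : schur) : schur :=
  MkSchur (schur_act_subproof g t).

Fact schur_act_linear g : linear (schur_act g).
Proof. by move=> a x y; apply: val_inj; rewrite /= linearP. Qed.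

Fact schur_act1 t : schur_act 1%g t = t.
Proof.
apply: val_inj => /=; elim/tensor_ind: (schur_val t) => [a x y Ex Ey||c].
- by rewrite linearP /= Ex Ey.
- by rewrite linear0.
rewrite tensor_mapE; congr pure_tensor; apply/ffunP=> i.
rewrite ffunE; exact: GL1E.
Qed.

Fact schur_actM g h t : schur_act (g * h)%g t = schur_act g (schur_act h t).
Proof.
apply: val_inj => /=; elim/tensor_ind: (schur_val t) => [a x y Ex Ey||c].
- by rewrite !linearP /= Ex Ey.
- by rewrite !linear0.
rewrite !tensor_mapE; congr pure_tensor; apply/ffunP=> i.
rewrite !ffunE; exact: GLME.
Qed.

Definition schur_rep : repMod K (GL V) :=
  RepMod schur_act_linear schur_act1 schur_actM.
End Functor.
End SchurFunctor.

Section JacobiDiagrams.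
Variables (T U : finType).

(* The half-edges of a diagram with set of trivalent vertices T and set of    *)
(* univalent vertices U. The cyclic order at v is (v,0) -> (v,1) -> (v,2).    *)
Definition half_edge := ((T * 'I_3) + U)%type.
HB.instance Definition _ := Finite.on half_edge.

Definition next (h : half_edge) : half_edge :=
  match h with
  | inl (v, i) => inl (v, ordS i)
  | inr u => inr u
  end.

Definition slot (v : T) (i : nat) : half_edge := inl (v, inord i).

(* The edges are the orbits of a fixed point free involution e.               *)
Definition is_jacobi (e : {perm half_edge}) : bool :=
  [forall h, (e h != h) && (e (e h) == h)] &&
  [forall h, [exists u : U,
     connect (fun h1 h2 => (h2 == next h1) || (h2 == e h1)) h (inr u)]].

Record jacobi := Jacobi { edge :> {perm half_edge}; _ : is_jacobi edge }.
HB.instance Definition _ := [isSub for edge].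
HB.instance Definition _ := [Finite of jacobi by <:].

Variables (K : fieldType) (V : vectType K).

Record colored_jacobi := Colored {
  diagram :> jacobi;
  color : {ffun U -> V}
}.

Definition colored_pair (D : colored_jacobi) := (diagram D, color D).
Definition pair_colored (p : jacobi * {ffun U -> V}) := Colored p.1 p.2.
Fact colored_pairK : cancel colored_pair pair_colored.
Proof. by case. Qed.
HB.instance Definition _ := Choice.copy colored_jacobi (can_type colored_pairK).

(* Commuting with [next], p preserves vertices, valences and cyclic orders.   *)
Definition jacobi_iso (p : {perm half_edge}) (D D' : colored_jacobi) : Prop :=
  [/\ forall h, p (next h) = next (p h),
      forall h, p (D h) = D' (p h) &
      forall u u', p (inr u) = inr u' -> color D' u' = color D u].

Definition flip (v : T) : {perm half_edge} := tperm (slot v 1) (slot v 2).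

(* The cycle (v,1) -> (v,2) -> (w,1) -> (v,1).                                *)
Definition rot3 (v w : T) : {perm half_edge} :=
  (tperm (slot v 1) (slot v 2) * tperm (slot v 1) (slot w 1))%g.

(* [D ^ p] re-attaches at the slot p h whatever D attaches at the slot h. For *)
(* an edge joining (v,0) to (w,0), v != w, and a, b, c, d attached at (v,1),  *)
(* (v,2), (w,1), (w,2), the trees D, D ^ rot3, D ^ (rot3 ^ 2) read            *)
(* [[a,b],c], [[c,a],b], [[b,c],a] with root d, so that IHX is the Jacobi     *)
(* identity.                                                                  *)
Inductive jacobi_rel : {malg K[colored_jacobi]} -> Prop :=
| JacobiMultilinear (D : jacobi) r :
    multilinear_rel (Colored D) r -> jacobi_rel r
| JacobiIso p (D D' : colored_jacobi) :
    jacobi_iso p D D' -> jacobi_rel (<< D >> - << D' >>)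
| JacobiAS v (D D' : jacobi) c :
    edge D' = (edge D ^ flip v)%g ->
    jacobi_rel (<< Colored D c >> + << Colored D' c >>)
| JacobiIHX v w (D D' D'' : jacobi) c :
    v != w -> D (slot v 0) = slot w 0 ->
    edge D' = (edge D ^ rot3 v w)%g ->
    edge D'' = (edge D' ^ rot3 v w)%g ->
    jacobi_rel (<< Colored D c >> + << Colored D' c >> + << Colored D'' c >>).

Definition jacobi_space := lquot jacobi_rel.
HB.instance Definition _ := GRing.Lmodule.on jacobi_space.

Definition jacobi_class (D : colored_jacobi) : jacobi_space :=
  lproj jacobi_rel << D >>.

Definition recolor (f : V -> V) (D : colored_jacobi) : colored_jacobi :=
  Colored D (fmap f (color D)).

Definition jacobi_map (f : V -> V) : jacobi_space -> jacobi_space :=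
  lquot_map jacobi_rel jacobi_rel
    (free_lift (fun D => << recolor f D >> : {malg K[colored_jacobi]})).

Lemma jacobi_map_rel (f : {linear V -> V}) r : jacobi_rel r ->
  free_lift (fun D => << recolor f D >> : {malg K[colored_jacobi]}) r
    \in lspan jacobi_rel.
Proof.
move=> Rr; apply: lspan_gen; case: r / Rr.
- move=> D _ [c [i [a [x [y ->]]]]]; apply: (JacobiMultilinear (D := D)).
  exists (fmap f c), i, a, (f x), (f y).
  rewrite free_lift_rel.
  by rewrite /recolor /= !fmap_update linearP.
- move=> p D D' [pN pE pC]; rewrite free_liftUB.
  apply: (JacobiIso (p := p)); split; [exact: pN | exact: pE |].
  by move=> u u' /pC eC; rewrite /= !ffunE eC.
- move=> v D D' c DD'; rewrite free_liftUD.
  exact: JacobiAS DD'.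
- move=> v w D D' D'' c vw Dvw DD' DD''; rewrite free_liftUDD.
  exact: JacobiIHX vw Dvw DD' DD''.
Qed.

Lemma jacobi_map_linear (f : {linear V -> V}) : linear (jacobi_map f).
Proof. exact/lquot_map_linear/jacobi_map_rel. Qed.

HB.instance Definition _ (f : {linear V -> V}) := GRing.isLinear.Build K
  jacobi_space jacobi_space _ (jacobi_map f) (jacobi_map_linear f).

Lemma jacobi_mapE (f : {linear V -> V}) D :
  jacobi_map f (jacobi_class D) = jacobi_class (recolor f D).
Proof.
rewrite /jacobi_map lquot_mapE /= ?free_liftU // => r.
exact: jacobi_map_rel.
Qed.

Lemma jacobi_ind (P : jacobi_space -> Prop) :
  (forall a x y, P x -> P y -> P (a *: x + y)) -> P 0 ->
  (forall D, P (jacobi_class D)) -> forall t, P t.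
Proof.
move=> PP P0 PD t; rewrite -[t]lreprK [lrepr t]monalgE linear_sum.
apply: (big_ind P) => // [x y Px Py|D _].
  by rewrite -[x]scale1r; apply: PP.
have -> : << (lrepr t)@_D *g D >> = (lrepr t)@_D *: << D >>
    :> {malg K[colored_jacobi]}.
  by apply/malgP=> y; rewrite mcoeffZ !mcoeffU mulrnAr mulr1.
rewrite linearZ /= -[_ *: _]addr0; apply: PP => //.
exact: PD.
Qed.

Definition jacobi_act (g : GL V) : jacobi_space -> jacobi_space := jacobi_map g.

Fact jacobi_act_linear g : linear (jacobi_act g).
Proof. exact: jacobi_map_linear. Qed.

Fact jacobi_act1 t : jacobi_act 1%g t = t.
Proof.
elim/jacobi_ind: t => [a x y Ex Ey||[D c]].
- by rewrite jacobi_act_linear Ex Ey.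
- by rewrite /jacobi_act linear0.
rewrite /jacobi_act jacobi_mapE; congr (jacobi_class (Colored _ _)).
apply/ffunP=> i; rewrite ffunE; exact: GL1E.
Qed.

Fact jacobi_actM g h t : jacobi_act (g * h)%g t = jacobi_act g (jacobi_act h t).
Proof.
elim/jacobi_ind: t => [a x y Ex Ey||[D c]].
- by rewrite !jacobi_act_linear Ex Ey.
- by rewrite /jacobi_act !linear0.
rewrite /jacobi_act !jacobi_mapE; congr (jacobi_class (Colored _ _)).
apply/ffunP=> i; rewrite !ffunE; exact: GLME.
Qed.

Definition jacobi_rep : repMod K (GL V) :=
  RepMod jacobi_act_linear jacobi_act1 jacobi_actM.
End JacobiDiagrams.

(* B_{d,k}: k trivalent and 2d - k univalent vertices. When k > 2d the        *)
(* truncated subtraction leaves no univalent vertex but k > 0 trivalent ones, *)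
(* so there is no diagram and the space is 0, as it should be.                *)
Definition jacobi_B (K : fieldType) (V : vectType K) (d k : nat) :
  repMod K (GL V) := jacobi_rep 'I_k 'I_(2 * d - k)%N V.

Definition is_partition (l : seq nat) := sorted geq l && all (leq 1%N) l.

(* A partition of m has at most m parts, each at most m.                      *)
Definition bounded_partition (m : nat) (l : m.-bseq 'I_m.+1) : bool :=
  is_partition (map val l) && (sumn (map val l) == m).

Record partition_of (m : nat) := PartitionOf {
  partition_bseq : m.-bseq 'I_m.+1;
  _ : bounded_partition partition_bseq
}.
HB.instance Definition _ m := [isSub for @partition_bseq m].
HB.instance Definition _ m := [Finite of partition_of m by <:].

Coercion parts m (l : partition_of m) : seq nat := map val (partition_bseq l).

Lemma partitionP m (l : seq nat) :
  reflect (exists p : partition_of m, l = p) (is_partition l && (sumn l == m)).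
Proof.
apply: (iffP idP) => [/andP[lP /eqP lm]|[[p pP] ->]]; last exact: pP.
have pos : all (leq 1) l by case/andP: lP.
have sz : (size l <= m)%N.
  rewrite -lm; elim: l pos {lP lm} => //= a l IH /andP[a1 /IH ll].
  by rewrite -add1n leq_add.
have bd x : x \in l -> (x < m.+1)%N.
  rewrite ltnS -lm; elim: l {lP lm pos sz} => //= a l IH.
  rewrite inE => /orP[/eqP ->|/IH xl]; first exact: leq_addr.
  exact: leq_trans xl (leq_addl _ _).
have El : map val (map (inord : nat -> 'I_m.+1) l) = l.
  rewrite -map_comp -[RHS]map_id; apply/eq_in_map => x xl /=.
  by rewrite inordK ?bd.
have sz' : (size (map (inord : nat -> 'I_m.+1) l) <= m)%N by rewrite size_map.
have bP : bounded_partition (Bseq sz').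
  by rewrite /bounded_partition /= El lP lm eqxx.
by exists (PartitionOf bP); rewrite /parts /= El.
Qed.

Definition double_partition (l : seq nat) : seq nat := map double l.

Definition three_odd_parts (l : seq nat) : bool := count odd l == 3%N.

(* Main.v *)
Require Import Defs.
From HB Require Import structures.
From mathcomp Require Import all_boot all_order all_fingroup all_algebra.
From mathcomp Require Import boolp zify.
From mathcomp.multinomials Require Import monalg.

(* Let m be the number of univalent vertices, S the set of half-edges at the  *)
(* trivalent vertices (0 or 3 of them) and U the set of univalent vertices.   *)
(* Fix a diagram without loop edges; it induces an involution iota of U whose *)
(* fixed points are the legs attached to S. Up to a nonzero scalar, the space *)
(* of diagrams is the image of e = sum of sign(h | Fix iota) h over the       *)
(* centralizer of iota, acting on V^{(x) U}. So it suffices to decompose e in *)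
(* the group algebra A of Sym(U) over the rationals; more precisely to find   *)
(* x_l in e A c_l and y_l in c_l A e with y_l x_k = [l = k] c_l and           *)
(* sum_l x_l y_l = e, where l runs over the partitions of m with exactly #|S| *)
(* odd parts and the c_l are Young symmetrizers.                              *)
(*   The c_l are primitive and pairwise orthogonal. We have e c_l <> 0 for a  *)
(* tableau whose rows are unions of iota-orbits, because all the terms        *)
(* contributing to the coefficient of 1 are positive. By positivity of the    *)
(* form (x, y) |-> coefficient of 1 in x^* y this yields x_l, y_l with        *)
(* y_l x_l = c_l, so that the x_l y_l are linearly independent in e A e. On   *)
(* the other hand e g e depends, up to sign, only on the pair of involutions  *)
(* (iota, iota^g) up to simultaneous conjugation, i.e. on the sizes of its    *)
(* orbits, which are paths and cycles; and e g e = 0 if some path has an even *)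
(* number of points, since its reversal swaps two fixed points of only one of *)
(* the two involutions. Hence dim e A e is at most the number of partitions   *)
(* l, and sum_l x_l y_l is the unit of e A e.                                 *)

(** With at most one trivalent vertex IHX is vacuous, and [jacobi_class_conj] combines AS with
    isomorphism invariance: permuting the slots and the colored legs changes a class only by the
    sign of the slot permutation. A loop edge makes a class vanish ([jacobi_class_loop]), and every
    diagram without one is a relabelling of the standard diagram ([std_isos_neq0]). So
    [rep_iso_jacobi] identifies the diagram space, up to nonzero scalars, with the image of e, which
    is [fix_sum].

    The splitting of e is [fix_sum_decomposition]. It plays a lower bound, from
    [fix_sum_row_col_neq0] and [young_orthogonal], against an upper bound, [double_coset_space];
    [decomposition] extracts the elements x_l and y_l, and [rep_iso_dsum] turns them into an
    isomorphism onto the sum of the Schur functors. For k = 0, the partitions of 2d without odd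
    parts are the doubles of the partitions of d; for k = 1, the three slots account for the three
    odd parts. *)

Set Implicit Arguments.
Unset Strict Implicit.
Unset Printing Implicit Defensive.

Import Order.TTheory GRing.Theory Num.Theory.

(** * Tableaux *)

Section Tableaux.
Variables (T : finType).
Implicit Types (l : seq nat) (r c d : T -> nat).

(* r and c are the row and column of the entries of a bijective filling of    *)
(* the diagram with row lengths l, which need not be sorted.                  *)
Definition tableau l r c :=
  [/\ forall x y, r x = r y -> c x = c y -> x = y,
      forall x, (c x < nth 0%N l (r x))%N &
      sumn l = #|T|].

Lemma card_box l : #|{: box l}| = sumn l.
Proof.
rewrite card_tagged !sumnE big_map big_enum /= [RHS](big_nth 0%N) big_mkord.
by apply: eq_bigr => i _; rewrite card_ord.
Qed.

Lemma tableau_surj l r c i j : tableau l r c -> (j < nth 0 l i)%N ->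
  exists x, r x = i /\ c x = j.
Proof.
move=> [inj bd sz] jl.
(* Beyond the end of l, [nth] returns the default length 0. *)
have lt_size k n : (k < nth 0 l n)%N -> (n < size l)%N.
  by case: (ltnP n (size l)) => // ln; rewrite nth_default.
pose f x : box l := Tagged (fun i : 'I_(size l) => 'I_(nth 0%N l i))
  (Ordinal (bd x) : 'I_(nth 0%N l (Ordinal (lt_size _ _ (bd x))))).
have f_inj : injective f.
  move=> x y fxy; apply: inj.
    exact: (congr1 (@box_row l) fxy).
  exact: (congr1 (@box_col l) fxy).
pose b : box l := Tagged (fun i : 'I_(size l) => 'I_(nth 0%N l i))
  (Ordinal jl : 'I_(nth 0%N l (Ordinal (lt_size _ _ jl)))).
have /codomP[x bE] : b \in codom f.
  by apply: inj_card_onto => //; rewrite card_box sz.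
exists x; split.
  exact: (congr1 (@box_row l) (esym bE)).
exact: (congr1 (@box_col l) (esym bE)).
Qed.

(** The source of most permutations below: conjugations of involutions and the factorization of g
    into a row and a column permutation all compare two fillings of one shape. *)
Lemma tableau_perm l r c r' d : tableau l r c ->
  (forall x y, r' x = r' y -> d x = d y -> x = y) ->
  (forall x, d x < nth 0 l (r' x))%N ->
  exists p : {perm T}, forall x, r (p x) = r' x /\ c (p x) = d x.
Proof.
move=> tab inj bd.
have [f fP] := fin_all_exists (fun x => tableau_surj tab (bd x)).
have f_inj : injective f.
  move=> x y fxy; have [rx cx] := fP x; have [ry cy] := fP y.
  by apply: inj; rewrite -?rx -?cx fxy.
by exists (perm f_inj) => x; rewrite permE.
Qed.

Lemma card_tableau_row l r c i : tableau l r c ->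
  #|[set x | r x == i]| = nth 0%N l i.
Proof.
move=> tab; have [inj bd _] := tab.
have [f fP] := fin_all_exists
  (fun j : 'I_(nth 0%N l i) => tableau_surj tab (ltn_ord j)).
have f_inj : injective f.
  move=> j k fjk; apply: val_inj => /=.
  by have [_ <-] := fP j; have [_ <-] := fP k; rewrite fjk.
rewrite -[RHS]card_ord -cardsT -(card_imset _ f_inj); apply: eq_card => x.
rewrite inE; apply/eqP/imsetP => [rx|[j _ ->]]; last by case: (fP j).
have cx : (c x < nth 0 l i)%N by rewrite -rx.
exists (Ordinal cx) => //; have [rf cf] := fP (Ordinal cx).
by apply: inj; rewrite ?rf ?cf.
Qed.

(** Induction on n, removing an element where d is maximal: the maximum of n + 1 distinct naturals
    is at least n. *)
Lemma leqif_sum_inj n (X : {set T}) d : #|X| = n -> {in X &, injective d} ->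
  (\sum_(j < n) j <= \sum_(x in X) d x ?= iff [forall x in X, d x < n])%N.
Proof.
elim: n X => [|n IHn] X Xn dinj.
  rewrite big_ord0; move/eqP: Xn; rewrite cards_eq0 => /eqP ->.
  rewrite big_set0; split=> //; rewrite eqxx; apply/esym/forallP => x.
  by rewrite inE.
have /card_gt0P[x0 x0X] : (0 < #|X|)%N by rewrite Xn.
have [m] := @arg_maxnP _ x0 (mem X) d x0X; rewrite [mem X m]topredE => mX max_m.
have dm : (n <= d m)%N.
  pose f x : 'I_(d m).+1 := inord (d x).
  rewrite -ltnS -Xn -[leqRHS]card_ord.
  apply: (@leq_card_in _ _ f) => // x y xX yX /(congr1 val).
  rewrite /= !inordK ?ltnS; [exact: dinj|exact: max_m|exact: max_m].
have Xm : #|X :\ m| = n by move: Xn; rewrite (cardsD1 m) mX => -[].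
have dinj' : {in X :\ m &, injective d}.
  by move=> x y /setD1P[_ xX] /setD1P[_ yX]; apply: dinj.
have := leqif_add (leqif_eq dm) (IHn _ Xm dinj').
rewrite big_ord_recr /= addnC (big_setD1 m mX) /=.
suff -> : (n == d m) && [forall x in X :\ m, d x < n]%N =
  [forall x in X, d x < n.+1]%N by [].
apply/andP/forall_inP => [[/eqP -> /forall_inP dX] x xX|dX].
  by rewrite ltnS; apply: max_m.
have dmn : n = d m by apply/eqP; rewrite eqn_leq dm -ltnS dX.
split; first exact/eqP.
apply/forall_inP => x /setD1P[xm xX]; rewrite ltn_neqAle -ltnS dX // andbT.
by apply: contra xm => /eqP dx; apply/eqP/dinj => //; rewrite dx.
Qed.

(* This takes the place of the dominance order on partitions: the sum of d    *)
(* over a row is minimal exactly when d enumerates the columns of the row.    *)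
Lemma tableau_col_bound l r c d : tableau l r c ->
  (forall x y, r x = r y -> d x = d y -> x = y) ->
  (\sum_x d x <= \sum_x c x)%N ->
  forall x, (d x < nth 0 l (r x))%N.
Proof.
move=> tab dinj; have [cinj cbd _] := tab.
pose rr x : 'I_(size l).+1 := inord (r x).
have rrE x : rr x = r x :> nat.
  rewrite inordK // ltnS leqNgt; apply/negP => lr.
  by have := cbd x; rewrite nth_default // ltnW.
pose Y i := [set x | r x == i].
have sumE f : (\sum_x f x = \sum_(i < (size l).+1) \sum_(x in Y i) f x)%N.
  rewrite (partition_big rr predT) //=; apply: eq_bigr => i _.
  by apply: eq_bigl => x; rewrite inE -val_eqE /= rrE.
have rowP f : (forall x y, r x = r y -> f x = f y -> x = y) -> forall i,
    (\sum_(j < nth 0 l i) j <= \sum_(x in Y i) f x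
        ?= iff [forall x in Y i, f x < nth 0 l i])%N.
  move=> finj i; apply: leqif_sum_inj; first exact: card_tableau_row tab.
  by move=> x y; rewrite !inE => /eqP rx /eqP ry; apply: finj; rewrite rx.
have cE i : (\sum_(x in Y i) c x = \sum_(j < nth 0 l i) j)%N.
  apply/eqP; rewrite eq_sym (rowP c cinj i).
  by apply/forall_inP => x; rewrite inE => /eqP <-.
rewrite !sumE => le_dc x.
(* In each row the sum of d is at least that of c, and the total of d is at most that of c, so
   equality holds in every row. *)
have lei (i : 'I_(size l).+1) (_ : true) := rowP d dinj i.
have := leqif_sum lei => -[_]; under [X in X == _]eq_bigr do rewrite -cE.
rewrite eqn_leq le_dc andbT => /esym; rewrite leq_sum => [|i _]; last first.
  by rewrite cE; case: (rowP d dinj i).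
by move/forallP/(_ (rr x))/forall_inP; rewrite rrE; apply; rewrite inE.
Qed.

Lemma count_nth (P : pred nat) (s : seq nat) :
  count P s = #|[set i : 'I_(size s) | P (nth 0%N s i)]|.
Proof.
rewrite -sum1_count (big_nth 0%N) big_mkord -sum1_card.
by apply: eq_bigl => i; rewrite inE.
Qed.

Lemma card_tableau_col l r c j : tableau l r c ->
  #|[set x | c x == j]| = count (ltn j) l.
Proof.
move=> tab; have [inj bd _] := tab; rewrite count_nth.
have rbd x : (r x < size l)%N.
  by rewrite ltnNge; apply/negP => lr; have := bd x; rewrite nth_default.
pose f x := Ordinal (rbd x).
rewrite -(card_in_imset (f := f)) => [|x y]; last first.
  rewrite !inE => /eqP cx /eqP cy /(congr1 val) /= rxy.
  by apply: inj; rewrite // cx.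
apply: eq_card => i; rewrite inE; apply/imsetP/idP => [[x xj ->]|].
  by rewrite inE in xj; rewrite /= -(eqP xj).
move=> /(tableau_surj tab)[x [rx cx]]; exists x; first by rewrite inE cx.
exact: val_inj.
Qed.

(** The counts are the column lengths, that is, the conjugate partition. Their consecutive
    differences are the multiplicities of the parts, which determine a sorted list. *)
Lemma partition_eq_count l l' : is_partition l -> is_partition l' ->
  (forall j, count (ltn j) l = count (ltn j) l') -> l = l'.
Proof.
move=> /andP[ls lp] /andP[ls' lp'] E.
apply: (sorted_eq (leT := geq)) => //.
- by move=> y x z yx zy; exact: leq_trans zy yx.
- by move=> x y; rewrite /geq /= andbC -eqn_leq => /eqP.
have cE s j : count (ltn j) s = (count_mem j.+1 s + count (ltn j.+1) s)%N.
  rewrite -count_predUI -[LHS]addn0; congr (_ + _)%N; last first.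
    by apply/esym/eqP; rewrite -leqn0 leqNgt -has_count; apply/hasPn => x _ /=;
       case: eqP => // ->; rewrite ltnn.
  by apply: eq_count => x; rewrite /= leq_eqVlt eq_sym.
apply/allP => -[|x] _ /=.
  have n0 s : all (leq 1) s -> 0%N \notin s.
    by move/allP => s1; apply/negP => /s1.
  by rewrite !(count_memPn _) ?n0.
by apply/eqP/(@addIn (count (ltn x.+1) l)); rewrite -cE E cE E.
Qed.
End Tableaux.

(* Pairs the columns 2k and 2k+1 of a row of length n; if n is odd, the last  *)
(* column is fixed.                                                           *)
Definition domino (n k : nat) : nat :=
  if odd k then k.-1 else if (k.+1 < n)%N then k.+1 else k.

Lemma box_inj l (b b' : box l) :
  box_row b = box_row b' -> box_col b = box_col b' -> b = b'.
Proof.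
case: b b' => [i j] [i' j']; rewrite /box_row /box_col /= => ii.
have {}ii := val_inj ii; subst i' => jj.
by congr existT; apply: val_inj.
Qed.

Lemma domino_lt n k : (k < n)%N -> (domino n k < n)%N.
Proof.
rewrite /domino; case: ifP => [_|_]; first by case: k => //= k /ltnW.
by case: ifP.
Qed.

Lemma dominoK n k : (k < n)%N -> domino n (domino n k) = k.
Proof.
rewrite {2}/domino; case: ifP => [|o kn].
  by case: k => //= k; rewrite /domino => /negbTE -> ->.
case: ifP => [kn'|kn']; rewrite /domino /= o ?kn' //.
Qed.

(** The only column that [domino] leaves alone is the last one of an odd row, so the fixed points of
    iota will count the odd parts. *)
Lemma adapted_fix (T : finType) (iota : {perm T}) l (r c : T -> nat) :
  tableau l r c -> (forall x, r (iota x) = r x) ->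
  (forall x, c (iota x) = domino (nth 0%N l (r x)) (c x)) ->
  forall x, (iota x == x) = ~~ odd (c x) && (nth 0 l (r x) == (c x).+1)%N.
Proof.
move=> tab rI cI x; have [inj bd _] := tab.
apply/eqP/andP => [ix|[c0 /eqP n1]].
  have E := cI x; rewrite ix /domino in E; have lt := bd x.
  case: ifP E => [o|o].
    by move: o; case: (c x) => // k _ /= /eqP; rewrite eqn_leq ltnn.
  case: ifP => [_ /eqP|n1 _]; first by rewrite eqn_leq ltnn andbF.
  by split=> //; rewrite eqn_leq lt andbT leqNgt n1.
by apply: inj => //; rewrite cI /domino (negbTE c0) n1 ltnn.
Qed.

Section LabelledRows.
Variables (T : finType) (T' : eqType) (rho : T -> T') (c : T -> nat).
Hypothesis rho_inj : forall x y, rho x = rho y -> c x = c y -> x = y.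
Hypothesis c_lt : forall x, (c x < #|[set y | rho y == rho x]|)%N.

(** Turns orbits into rows: the labels that occur are sorted by decreasing fibre size, and the row
    of x is the position of its label. *)
Lemma labelled_tableau : exists l r,
  [/\ is_partition l, tableau l r c, forall x y, (r x == r y) = (rho x == rho y) &
      forall x, nth 0%N l (r x) = #|[set y | rho y == rho x]|].
Proof.
pose sz a := #|[set y | rho y == a]|.
pose L := sort (fun a b => sz b <= sz a)%N (undup (codom rho)).
pose l := map sz L; pose r x := index (rho x) L.
have rhoL x : rho x \in L by rewrite mem_sort mem_undup codom_f.
have rL x : (r x < size L)%N by rewrite index_mem.
have lE x : nth 0%N l (r x) = sz (rho x).
  by rewrite (nth_map (rho x)) ?nth_index.
have rE x y : (r x == r y) = (rho x == rho y).
  apply/eqP/eqP => [|E]; last by rewrite /r E.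
  by move/(congr1 (nth (rho x) L)); rewrite !nth_index.
exists l, r; split=> //.
- apply/andP; split.
    rewrite sorted_map; apply: sort_sorted => a b; exact: leq_total.
  apply/allP => _ /mapP[a aL ->]; move: aL; rewrite mem_sort mem_undup.
  by case/codomP => x ->; apply/card_gt0P; exists x; rewrite inE.
split=> [x y rxy|x|].
- by apply: rho_inj; apply/eqP; rewrite -rE rxy.
- by rewrite lE c_lt.
rewrite sumnE big_map (perm_big (undup (codom rho))) ?perm_sort //=.
under eq_bigr => a _ do rewrite /sz -sum1_card big_mkcond.
rewrite exchange_big -sum1_card; apply: eq_bigr => x _ /=.
rewrite (eq_bigr (fun a => (a == rho x) : nat)) => [|a _]; last first.
  by rewrite inE eq_sym; case: eqP.
by rewrite -big_mkcond sum1_count count_uniq_mem ?undup_uniq // mem_undup codom_f.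
Qed.
End LabelledRows.

(** * Conjugacy of involutions and adapted tableaux *)

Section Involutions.
Variable T : finType.
Implicit Types (i : {perm T}) (l : seq nat).

(** The rows are the orbits. The last clause says that the shape depends only on #|T| and the number
    of fixed points, as [involution_conj] requires. *)
Lemma involution_tableau i : (forall x, i (i x) = x) ->
  exists l r c, [/\ is_partition l, tableau l r c,
    forall x, r (i x) = r x,
    forall x, c (i x) = if (nth 0 l (r x) == 2)%N then (~~ (c x == 1) : nat) else 0 &
    forall j, count (ltn j) l =
      if j is j'.+1 then if j' is 0%N then (#|T| - #|[set x | i x == x]|)./2 else 0
      else #|T| - (#|T| - #|[set x | i x == x]|)./2]%N.
Proof.
move=> iK; pose rho x := [set x; i x].
(* In a 2-cycle, column 1 goes to the element of larger [enum_rank]. *)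
pose c x : nat := (enum_rank (i x) < enum_rank x)%N.
have rhoE x y : (rho y == rho x) = (y \in rho x).
  apply/eqP/idP => [<-|]; first by rewrite !inE eqxx.
  by rewrite !inE => /orP[] /eqP -> //; rewrite /rho iK setUC.
have rhoi x : rho (i x) = rho x by rewrite /rho iK setUC.
have card_rho x : #|[set y | rho y == rho x]| = (i x != x).+1.
  transitivity #|rho x|; last by rewrite cards2 eq_sym.
  by apply: eq_card => y; rewrite inE rhoE.
have c1 x : i x != x -> c (i x) = ~~ (c x == 1%N).
  move=> ix; rewrite /c iK eqb1 -leqNgt ltn_neqAle (inj_eq val_inj).
  by rewrite (inj_eq enum_rank_inj) eq_sym ix.
have c0 x : i x = x -> c x = 0%N by move=> ix; rewrite /c ix ltnn.
have [|x|l [r [lP tab rE lE]]] := @labelled_tableau _ _ rho c.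
- move=> x y /esym/eqP; rewrite rhoE !inE => /orP[] /eqP -> //.
  have [-> //|ix] := eqVneq (i x) x.
  by move/eqP; rewrite c1 // /c; case: (_ < _)%N.
- by rewrite card_rho /c; case: eqP => [->|_]; rewrite ?ltnn // ltnS leq_b1.
exists l, r, c; split=> //.
- by move=> x; apply/eqP; rewrite rE rhoi.
- move=> x; rewrite lE card_rho; have [ix|ix] := eqVneq (i x) x; last exact: c1.
  by rewrite ix c0.
have c_le1 x : (c x <= 1)%N by rewrite leq_b1.
have E1 : (#|[set x | c x == 1%N]| = (#|T| - #|[set x | i x == x]|)./2)%N.
  have -> : (#|T| - #|[set x | i x == x]| = #|[set x | i x != x]|)%N.
    rewrite -cardsT -[in LHS](cardsID [set x | i x == x] setT) setTI addKn.
    by apply: eq_card => x; rewrite !inE andbT.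
  set A := [set x | c x == 1%N]; set F := [set x | i x != x].
  rewrite -(cardsID A F).
  have FA : F :&: A = A.
    apply/setIidPr/subsetP => x; rewrite !inE; apply: contraTneq => /c0 ->.
    by [].
  have FD : F :\: A = i @^-1: A.
    apply/setP=> x; rewrite !inE; have [ix|ix] := eqVneq (i x) x.
      by rewrite ix c0.
    by rewrite c1 // eqb1 andbT.
  by rewrite FA FD card_preimset ?addnn ?doubleK //; apply: perm_inj.
move=> [|[|j]]; rewrite -(card_tableau_col _ tab) ?E1 //.
- rewrite -E1 -cardsT -(cardsID [set x | c x == 1%N] setT) setTI addKn.
  by apply: eq_card => x; rewrite !inE andbT; have := c_le1 x; case: (c x) => [|[]].
apply/eqP; rewrite cards_eq0 -subset0; apply/subsetP => x; rewrite !inE.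
by have := c_le1 x; case: (c x) => [|[]].
Qed.

(** Both canonical tableaux have the same shape, and in their row and column coordinates both
    involutions are given by the same formula. *)
Lemma involution_conj i i' : (forall x, i (i x) = x) -> (forall x, i' (i' x) = x) ->
  #|[set x | i x == x]| = #|[set x | i' x == x]| ->
  exists g : {perm T}, forall x, g (i x) = i' (g x).
Proof.
move=> iK i'K E.
have [l [r [c [lP tab rI cI lE]]]] := involution_tableau iK.
have [l' [r' [c' [lP' tab' rI' cI' lE']]]] := involution_tableau i'K.
have ll : l = l' by apply: partition_eq_count => // j; rewrite lE lE' E.
have [inj bd _] := tab; have [inj' _ _] := tab'.
have [|p pP] := tableau_perm tab' inj; first by rewrite -ll.
exists p => x; have [rx cx] := pP x; have [rix cix] := pP (i x).
by apply: inj'; rewrite ?rI' ?cI' ?rx ?cx ?rix ?cix ?rI ?cI ?ll.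
Qed.

Lemma tableau_ex l : sumn l = #|T| -> exists r c : T -> nat, tableau l r c.
Proof.
move=> sz; have E : #|T| = #|{: box l}| by rewrite card_box.
pose b (x : T) : box l := enum_val (cast_ord E (enum_rank x)).
exists (fun x => box_row (b x)), (fun x => box_col (b x)); split=> //.
- by move=> x y rE cE; apply/enum_rank_inj/(@cast_ord_inj _ _ E)/enum_val_inj/box_inj.
by move=> x; apply: ltn_ord.
Qed.

Lemma card_adapted_fix i l (r c : T -> nat) : tableau l r c ->
  (forall x, r (i x) = r x) ->
  (forall x, c (i x) = domino (nth 0%N l (r x)) (c x)) ->
  #|[set x | i x == x]| = count odd l.
Proof.
move=> tab rI cI; have [inj bd _] := tab; rewrite count_nth.
have rbd x : (r x < size l)%N.
  by rewrite ltnNge; apply/negP => lr; have := bd x; rewrite nth_default.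
pose f x := Ordinal (rbd x).
have fixP := adapted_fix tab rI cI.
rewrite -(card_in_imset (f := f)) => [|x y]; last first.
  rewrite !inE !fixP => /andP[_ /eqP cx] /andP[_ /eqP cy] /(congr1 val) /= rxy.
  by apply: inj => //; apply: succn_inj; rewrite -cx -cy rxy.
apply: eq_card => k; rewrite inE; apply/imsetP/idP => [[x + ->]|ok].
  by rewrite inE fixP => /andP[c0 /eqP /= ->].
have n0 : (0 < nth 0 l k)%N by case: (nth _ _ _) ok.
have /(tableau_surj tab)[x [rx cx]] : ((nth 0 l k).-1 < nth 0 l k)%N by rewrite prednK.
exists x; last exact: val_inj.
by rewrite inE fixP cx rx prednK // eqxx andbT; case: (nth _ _ _) ok.
Qed.

(** In an arbitrary filling, [domino] defines an involution p with one fixed point per odd row. It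
    is conjugate to i, and the filling is transported along the conjugation. *)
Lemma adapted_tableau_ex i l : (forall x, i (i x) = x) -> sumn l = #|T| ->
  #|[set x | i x == x]| = count odd l ->
  exists r c : T -> nat, [/\ tableau l r c, forall x, r (i x) = r x &
    forall x, c (i x) = domino (nth 0%N l (r x)) (c x)].
Proof.
move=> iK sz E; have [r [c tab]] := tableau_ex sz; have [inj bd _] := tab.
have [||p pP] := @tableau_perm _ l r c r (fun x => domino (nth 0%N l (r x)) (c x)) tab.
- move=> x y rxy; rewrite rxy => /(congr1 (domino (nth 0%N l (r y)))).
  by rewrite !dominoK // -?rxy //; apply: inj.
- by move=> x; apply: domino_lt.
have rp x : r (p x) = r x by case: (pP x).
have cp x : c (p x) = domino (nth 0%N l (r x)) (c x) by case: (pP x).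
have pK x : p (p x) = x by apply: inj; rewrite ?rp // !cp rp dominoK.
have [|g gP] := involution_conj iK pK.
  by rewrite E (card_adapted_fix tab rp cp).
exists (r \o g), (c \o g); split=> [|x|x]; rewrite /= ?gP ?rp ?cp //.
split=> [x y /= rE cE|x|]; [|exact: bd|exact: sz].
by apply/(@perm_inj _ g)/inj.
Qed.
End Involutions.

(** * Pairs of involutions *)

(* Pairs the columns 2k+1 and 2k+2; column 0 is fixed if n is odd and paired  *)
(* with the last column if n is even.                                         *)
Definition shifted_domino (n k : nat) : nat :=
  if k == 0 then (if odd n then 0 else n.-1)
  else if odd k then (if k.+1 < n then k.+1 else 0) else k.-1.

Section Walk.
Variable T : finType.

Fixpoint walk (i j : T -> T) (z : T) (k : nat) : T :=
  if k is k'.+1 then (if odd k' then j else i) (walk i j z k') else z.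

(** The walk alternates i and j. At step n it either gets stuck at a fixed point, the end of a path,
    or closes up into a cycle. *)
Definition simple_walk (i j : T -> T) (z : T) (n : nat) : Prop :=
  [/\ 0 < n, forall k k', k < n -> k' < n -> walk i j z k = walk i j z k' -> k = k' &
      walk i j z n = walk i j z n.-1 \/ (walk i j z n = z /\ ~~ odd n)].

(* The situation in which e g e vanishes: h is even on the fixed points of i  *)
(* and odd on those of j.                                                     *)
Definition fix_swap (i j : T -> T) : Prop :=
  exists (h : {perm T}) z z', [/\ [/\ z != z', j z = z & j z' = z'],
    (forall x, h (i x) = i (h x)) /\ (forall x, h (j x) = j (h x)),
    forall x, i x = x -> h x = x &
    forall x, j x = x -> h x = tperm z z' x].

Definition glue (i j : T -> T) : rel T := fun x y => (y == i x) || (y == j x).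

(** Let n be the first step that repeats an earlier value, at step m say. Cancelling the last
    involution shows that m is n - 1 or 0; any other m contradicts injectivity below n or a
    parity. *)
Lemma simple_walk_ex (i j : T -> T) z : involutive i -> involutive j ->
  exists n, simple_walk i j z n.
Proof.
move=> iK jK; pose w := walk i j z.
have opK k x : (if odd k then j else i) ((if odd k then j else i) x) = x.
  by case: odd.
pose P n := w n \in map w (iota 0 n).
have uniqw n : (forall m, m < n -> ~~ P m) -> uniq (map w (iota 0 n)).
  elim: n => // n IHn nP; rewrite -addn1 iotaD map_cat cats1 rcons_uniq.
  by rewrite add0n nP // IHn // => m mn; apply/nP/ltnW.
have exP : exists n, P n.
  have [/existsP[m Pm]|] := boolP [exists m : 'I_#|T|.+1, P m]; first by exists m.
  rewrite negb_exists => /forallP nP.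
  have /card_uniqP : uniq (map w (iota 0 #|T|.+1)).
    by apply: uniqw => m mT; have := nP (Ordinal mT).
  rewrite size_map size_iota => E.
  by have := max_card (mem (map w (iota 0 #|T|.+1))); rewrite E ltnn.
case: (ex_minnP exP) => n Pn min_n.
have n0 : 0 < n by case: n Pn {min_n}.
have uw : uniq (map w (iota 0 n)).
  by apply: uniqw => m mn; apply: contraTN mn => /min_n; rewrite -leqNgt.
have wnth k : k < n -> nth z (map w (iota 0 n)) k = w k.
  by move=> kn; rewrite (nth_map 0) ?size_iota // nth_iota.
have inj k k' : k < n -> k' < n -> w k = w k' -> k = k'.
  move=> kn kn' E; apply/eqP.
  by rewrite -(nth_uniq z _ _ uw) ?size_map ?size_iota // !wnth ?E.
exists n; split=> //.
have /mapP[m] := Pn; rewrite mem_iota add0n => /= mn wn.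
case: n n0 mn wn inj {Pn min_n uw wnth} => // n _ mn wn inj.
have wn' : w n = (if odd n then j else i) (w m) by rewrite -wn /w /= opK.
move: mn; rewrite ltnS leq_eqVlt => /predU1P[mE|mn].
  by left; rewrite -/w wn mE.
right; case: m mn wn wn' => [|m] mn wn wn'.
  split=> //=; apply/negP => on; move: wn'; rewrite (negbTE on) /= => E.
  have {}E : w n = w 1 by [].
  by have nE := inj n 1 (ltnSn _) mn E; rewrite nE in on.
have [E|E] := boolP (odd n == odd m).
  have : w n = w m by rewrite wn' (eqP E) /w /= opK.
  by move/(inj _ _ (ltnSn _) (ltnW (ltnW mn))) => nm; rewrite nm ltnNge leqnSn in mn.
have E' : odd n = odd m.+1 by move: E => /=; do 2!case: odd.
have : w n = w m.+2 by rewrite wn' E'.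
move/(inj _ _ (ltnSn _)); rewrite ltnS => /(_ mn) nE.
by move: E'; rewrite nE /=; case: odd.
Qed.
Section SimpleWalk.
Variables (i j : T -> T) (z : T) (n : nat).
Hypotheses (iK : involutive i) (jK : involutive j) (sw : simple_walk i j z n).
Local Notation w := (walk i j z).

Lemma walkS k : w k.+1 = (if odd k then j else i) (w k).
Proof. by []. Qed.

Lemma walk_i k : k < n -> i (w k) = w (domino n k).
Proof.
have [n0 inj wn] := sw; move=> kn; rewrite /domino; case: ifP => ok.
  case: k ok {kn} => //= k /negbTE ok.
  by rewrite ok iK.
have -> : i (w k) = w k.+1 by rewrite walkS ok.
case: ltnP => // nk; have nE : n = k.+1 by apply/eqP; rewrite eqn_leq nk kn.
by move: wn; rewrite nE /= ok /=; case=> // -[].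
Qed.

Lemma walk_j k : k < n -> 0 < k -> k.+1 < n \/ ~~ odd k ->
  j (w k) = w (if odd k then k.+1 else k.-1).
Proof.
move=> kn k0 H; case: ifP => ok; first by rewrite walkS ok.
by case: k k0 ok {H kn} => //= k _ /negbFE ->; rewrite jK.
Qed.

Lemma walk_glue :
  j z = z \/ (w n = z /\ ~~ odd n) ->
  forall x, reflect (exists2 k, k < n & x = w k) (connect (glue i j) z x).
Proof.
have [n0 inj wn] := sw; move=> Hj x.
have jW k : k < n -> exists2 k', k' < n & j (w k) = w k'.
  move=> kn; case: (posnP k) => [->|k0].
    case: Hj => [jz|[wz on]]; first by exists 0.
    exists n.-1; first by rewrite prednK.
    move: wz; rewrite -{1}(prednK n0) walkS ifT => [E|]; first by rewrite /= -{1}E jK.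
    by move: on; rewrite -{1}(prednK n0) /= negbK.
  have [kn'|nk] := ltnP k.+1 n.
    exists (if odd k then k.+1 else k.-1); last by apply: walk_j; auto.
    by case: ifP => _ //; apply: leq_ltn_trans kn; apply: leq_pred.
  have nE : n = k.+1 by apply/eqP; rewrite eqn_leq nk kn.
  have [ok|ok] := boolP (odd k); last first.
    exists k.-1; last by rewrite walk_j ?(negbTE ok) //; right.
    by apply: leq_ltn_trans kn; apply: leq_pred.
  have -> : j (w k) = w n by rewrite nE walkS ok.
  by case: wn => [->|[-> _]]; [exists n.-1; rewrite ?prednK|exists 0].
apply: (iffP connectP) => [[p]|[k kn ->]]; last first.
  apply/connectP; elim: k {kn} => [|k IHk]; first exact: connect0.
  apply: connect_trans IHk (connect1 _); rewrite walkS /glue.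
  by case: odd; rewrite eqxx ?orbT.
have: exists2 k, k < n & z = w k by exists 0.
move: {1 3 4}z => y; elim: p y => [|y' p IHp] y /= [k kn yk].
  by move=> _ ->; exists k.
case/andP=> /orP[/eqP -> |/eqP ->]; apply: IHp.
  by exists (domino n k); rewrite ?domino_lt // yk walk_i.
by have [k' k'n E] := jW _ kn; exists k'; rewrite // yk E.
Qed.

Lemma walk_j_shifted k : (j z = z /\ odd n) \/ (w n = z /\ ~~ odd n) ->
  k < n -> j (w k) = w (shifted_domino n k).
Proof.
have [n0 inj wn] := sw; move=> Hj kn; rewrite /shifted_domino.
case: (posnP k) => [->|k0] /=.
  case: Hj => [[jz ->]|[wz on]]; [exact: jz|rewrite (negbTE on)].
  move: wz; rewrite -{1}(prednK n0) walkS ifT => [E|]; first by rewrite /= -{1}E jK.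
  by move: on; rewrite -{1}(prednK n0) /= negbK.
have [ok|ok] := boolP (odd k); last first.
  by rewrite walk_j ?(negbTE ok) //; right.
have [kn'|nk] := ltnP; first by rewrite walk_j ?ok //; left.
have nE : n = k.+1 by apply/eqP; rewrite eqn_leq nk kn.
have -> : j (w k) = w n by rewrite nE walkS ok.
by case: Hj => [[_]|[-> //]]; rewrite nE /= ok.
Qed.

Lemma walk_end : j z = z -> w n = w n.-1.
Proof.
have [n0 inj wn] := sw; move=> jz; case: wn => // -[wz on].
move: wz; rewrite -{1}(prednK n0) walkS ifT => [E|]; last first.
  by move: on; rewrite -{1}(prednK n0) /= negbK.
have : w n.-1 = w 0 by rewrite /= -[w n.-1]jK E.
move/inj; rewrite prednK // => /(_ (leqnn _) n0) n1.
by move: on; rewrite -(prednK n0) n1.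
Qed.

(** A path that starts at a fixed point of j and has an even number of points also ends at one.
    Reversing it commutes with i and j and swaps the two ends, while no point of it is fixed by
    i. *)
Lemma even_path_reversal : j z = z -> ~~ odd n -> fix_swap i j.
Proof.
have [n0 inj wn] := sw; move=> jz on; have wE := walk_end jz.
pose s := map w (iota 0 n).
have us : uniq s.
  rewrite map_inj_in_uniq ?iota_uniq // => k k'; rewrite !mem_iota add0n /=.
  exact: inj.
have ws k : k < n -> w k \in s by move=> kn; rewrite map_f // mem_iota.
have sP x : x \in s -> exists2 k, k < n & x = w k.
  by case/mapP => k; rewrite mem_iota add0n => /= kn ->; exists k.
have idxE k : k < n -> index (w k) s = k.
  move=> kn; have -> : w k = nth z s k by rewrite (nth_map 0) ?size_iota // nth_iota.
  by rewrite index_uniq // size_map size_iota.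
pose f x := if x \in s then w (n.-1 - index x s) else x.
have f_w k : k < n -> f (w k) = w (n.-1 - k) by move=> kn; rewrite /f ws // idxE.
have f_N x : x \notin s -> f x = x by rewrite /f => /negbTE ->.
have lt_rev k : n.-1 - k < n by rewrite -[X in _ < X](prednK n0) ltnS leq_subr.
have fK : involutive f.
  move=> x; have [/sP[k kn ->]|xs] := boolP (x \in s); last by rewrite !f_N.
  by rewrite !f_w // subKn // -ltnS prednK.
(* In walk coordinates j fixes 0 and n - 1 and pairs 2a + 1 with 2a + 2. *)
pose g k := if odd k then (if k.+1 < n then k.+1 else k) else k.-1.
have g_lt k : k < n -> g k < n by rewrite /g; do 2?case: ifP; lia.
have jw k : k < n -> j (w k) = w (g k).
  move=> kn; rewrite /g; case: (posnP k) => [->|k0] //=.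
  have [ok|ok] := boolP (odd k); last by rewrite walk_j ?(negbTE ok) //; right.
  have [kn'|nk] := ltnP; first by rewrite walk_j ?ok //; left.
  have nE : n = k.+1 by apply/eqP; rewrite eqn_leq nk kn.
  have -> : j (w k) = w n by rewrite nE walkS ok.
  by rewrite wE nE.
have fi x : f (i x) = i (f x).
  have [/sP[k kn ->]|xs] := boolP (x \in s); last first.
    rewrite [f x]f_N // f_N //; apply: contra xs => /sP[k kn E].
    by rewrite -[x]iK E walk_i // ws // domino_lt.
  rewrite walk_i // !f_w ?domino_lt // walk_i //; congr w.
  by move: on kn; rewrite /domino; do 4?case: ifP; lia.
have fj x : f (j x) = j (f x).
  have [/sP[k kn ->]|xs] := boolP (x \in s); last first.
    rewrite [f x]f_N // f_N //; apply: contra xs => /sP[k kn E].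
    by rewrite -[x]jK E jw // ws // g_lt.
  rewrite jw // !f_w ?g_lt // jw //; congr w.
  by move: on kn; rewrite /g; do 4?case: ifP; lia.
have n1 : n.-1 < n by rewrite prednK.
exists (perm (inv_inj fK)), z, (w n.-1); split.
- split=> //; last first.
    by rewrite jw // /g; case: ifP => [|/negP]; rewrite ?prednK ?ltnn //; lia.
  by apply/eqP => /(inj 0 n.-1 n0 n1) E; move: on; rewrite -(prednK n0) -E.
- by split=> x; rewrite !permE ?fi ?fj.
- move=> x ix; rewrite permE; have [/sP[k kn xE]|/f_N //] := boolP (x \in s).
  move: ix; rewrite xE walk_i // => /inj; rewrite domino_lt // => /(_ isT kn).
  by rewrite /domino; do 2?case: ifP; lia.
move=> x jx; rewrite permE; have [/sP[k kn xE]|xs] := boolP (x \in s); last first.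
  rewrite f_N // tpermD //; apply: contraNneq xs => <-; [exact: (ws 0)|exact: ws].
move: jx; rewrite xE jw // => /inj; rewrite g_lt // => /(_ isT kn) gk.
have [->|->] : k = 0 \/ k = n.-1 by move: gk; rewrite /g; do 2?case: ifP; lia.
  by rewrite -/(w 0) f_w // subn0 tpermL.
by rewrite f_w // subnn tpermR.
Qed.
End SimpleWalk.

Lemma glue_sym (i j : T -> T) : involutive i -> involutive j ->
  connect_sym (glue i j).
Proof.
move=> iK jK; apply: sym_connect_sym => x y; rewrite /glue.
by rewrite -(can2_eq iK iK x y) -(can2_eq jK jK x y) !(eq_sym y).
Qed.

Lemma shifted_domino_lt n k : k < n -> shifted_domino n k < n.
Proof. by rewrite /shifted_domino; do 3?case: ifP; lia. Qed.

(** Rows are the orbits of i and j together, columns are positions on a walk. An orbit is a cycle or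
    a path; a path with an even number of points yields a swap, and any other path has an end fixed
    by j, where the walk is made to start. *)
Lemma glue_tableau (i j : {perm T}) : involutive i -> involutive j ->
  [\/ fix_swap i j, fix_swap j i |
   exists l r c, [/\ is_partition l, tableau l r c,
    forall x, r (i x) = r x /\ r (j x) = r x,
    forall x, c (i x) = domino (nth 0 l (r x)) (c x) &
    forall x, c (j x) = shifted_domino (nth 0 l (r x)) (c x)]].
Proof.
move=> iK jK.
have [|nij] := asboolP (fix_swap i j); first by constructor 1.
have [|nji] := asboolP (fix_swap j i); first by constructor 2.
constructor 3; pose e := glue i j; have e_sym : connect_sym e by exact: glue_sym.
(* A starting point that depends only on the orbit: a fixed point of j if there is one, otherwise
   the root. *)
pose base x := odflt (fingraph.root e x)
  [pick z | connect e (fingraph.root e x) z && (j z == z)].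
have base_conn x : connect e (base x) x.
  rewrite e_sym /base; case: pickP => [z /andP[xz _]|_] /=; last exact: connect_root.
  exact: connect_trans (connect_root e x) xz.
have baseE x y : connect e x y -> base x = base y.
  by rewrite -(root_connect e_sym) => /eqP E; rewrite /base E.
have base_fix x : j (base x) = base x \/ forall y, connect e x y -> j y != y.
  rewrite /base; case: pickP => [z /andP[_ /eqP jz]|nz] /=; [by left|right=> y xy].
  have := nz y; rewrite (connect_trans _ xy) => [/= ->//|].
  by rewrite e_sym connect_root.
have exn x : exists n, simple_walk i j (base x) n /\
   (j (base x) = base x /\ odd n \/ walk i j (base x) n = base x /\ ~~ odd n).
  have [n sw] := simple_walk_ex (base x) iK jK; exists n; split=> //.
  have [jb|nj] := base_fix x.
    left; split=> //; apply: contra_notT nij => on.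
    exact: (even_path_reversal iK jK sw).
  (* If the walk got stuck in an orbit without fixed points of j, it would end at a fixed point y of
     i. Walking from y with the roles exchanged then gives an even path or reaches a fixed point of
     j. *)
  right; have [n0 inj []] := sw => // wE; exfalso.
  have conn_w k : connect e x (walk i j (base x) k).
    elim: k => [|k IHk]; first by rewrite e_sym base_conn.
    apply: connect_trans IHk (connect1 _); rewrite /e /glue /=.
    by case: odd; rewrite eqxx ?orbT.
  have on : odd n.-1 = false.
    apply/negP => on; have /eqP[] := nj _ (conn_w n.-1).
    by move: wE; rewrite -{1}(prednK n0) /= on.
  have iy : i (walk i j (base x) n.-1) = walk i j (base x) n.-1.
    by move: wE; rewrite -{1}(prednK n0) /= on.
  set y := walk _ _ _ _ in iy.
  have [m sw'] := simple_walk_ex y jK iK.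
  have [om|om] := boolP (odd m); last first.
    exact: nji (even_path_reversal jK iK sw' iy om).
  have wE' := walk_end iK sw' iy; have [m0 _ _] := sw'.
  have xw : connect e x (walk j i y m.-1).
    elim: (m.-1) => [|k IHk]; first exact: conn_w.
    apply: connect_trans IHk (connect1 _); rewrite /e /glue /=.
    by case: odd; rewrite eqxx ?orbT.
  have om' : odd m.-1 = false by move: om; rewrite -{1}(prednK m0) /=; case: odd.
  by have /eqP[] := nj _ xw; move: wE'; rewrite -{1}(prednK m0) /= om'.
have [n0 n0P] := choice exn; pose n x := n0 (fingraph.root e x).
have nP x : simple_walk i j (base x) (n x) /\
    (j (base x) = base x /\ odd (n x) \/
     walk i j (base x) (n x) = base x /\ ~~ odd (n x)).
  by rewrite (baseE _ _ (connect_root e x)); apply: n0P.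
have nE x y : connect e x y -> n x = n y.
  by rewrite -(root_connect e_sym) => /eqP E; rewrite /n E.
have glueP x y : reflect (exists2 k, k < n x & y = walk i j (base x) k) (connect e x y).
  rewrite -(same_connect e_sym (base_conn x)); have [sw H] := nP x.
  by apply: (walk_glue iK jK sw); case: H => [[-> _]|]; [left|right].
have exc x : exists k, k < n x /\ x = walk i j (base x) k.
  by have /glueP[k kn xE] := connect0 e x; exists k.
have [c cP] := choice exc.
have inj x k k' : k < n x -> k' < n x ->
    walk i j (base x) k = walk i j (base x) k' -> k = k'.
  by have [[_ inj _] _] := nP x; apply: inj.
have card_orbit x : #|[set y | fingraph.root e y == fingraph.root e x]| = n x.
  pose f (k : 'I_(n x)) := walk i j (base x) k.
  have f_inj : injective f by move=> k k' E; apply: val_inj; apply: inj E.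
  rewrite -[RHS]card_ord -cardsT -(card_imset _ f_inj); apply: eq_card => y.
  rewrite inE (root_connect e_sym) e_sym; apply/glueP/imsetP => [[k kn ->]|[k _ ->]].
    by exists (Ordinal kn).
  by exists k.
have [x y rxy cxy|x|l [r [lP tab rE lE]]] := @labelled_tableau _ _ (fingraph.root e) c.
- have exy : connect e x y by rewrite -(root_connect e_sym) rxy.
  by have [_ ->] := cP x; have [_ ->] := cP y; rewrite (baseE _ _ exy) cxy.
- by rewrite card_orbit; case: (cP x).
have ei x : connect e x (i x) by apply: connect1; rewrite /e /glue eqxx.
have ej x : connect e x (j x) by apply: connect1; rewrite /e /glue eqxx orbT.
have rR x y : connect e x y -> r y = r x.
  by move=> xy; apply/eqP; rewrite rE (root_connect e_sym) e_sym.
exists l, r, c; split=> // [x|x|x].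
- by split; apply: rR.
- rewrite lE card_orbit; have [[sw _] [cx xE]] := (nP x, cP x).
  have [ci iE] := cP (i x); rewrite -(nE _ _ (ei x)) -(baseE _ _ (ei x)) in ci iE.
  apply: (inj x) => //; first exact: domino_lt.
  by rewrite -iE {1}xE (walk_i iK sw).
rewrite lE card_orbit; have [[sw H] [cx xE]] := (nP x, cP x).
have [cj jE] := cP (j x); rewrite -(nE _ _ (ej x)) -(baseE _ _ (ej x)) in cj jE.
apply: (inj x) => //; first exact: shifted_domino_lt.
by rewrite -jE {1}xE (walk_j_shifted jK sw H).
Qed.
End Walk.

Local Open Scope ring_scope.

(** * The group algebra over the rationals *)

Section GroupAlgebra.
Variable gT : finGroupType.

(** Coefficients are rational whatever K is, because the argument uses positivity; [ratr] carries
    the resulting identities over to K. *)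
Definition galg := {ffun gT -> rat^o}.
HB.instance Definition _ := Vector.on galg.
Implicit Types x y z : galg.

Definition gel (g : gT) : galg := [ffun h => (h == g)%:R].
Definition galg_mul x y : galg :=
  [ffun g => \sum_h (x h : rat) * y (h^-1 * g)%g].

Lemma galg_mulA : associative galg_mul.
Proof.
move=> x y z; apply/ffunP=> g; rewrite !ffunE.
under eq_bigr => h _ do rewrite ffunE mulr_sumr.
under [RHS]eq_bigr => l _ do rewrite ffunE mulr_suml.
rewrite [RHS]exchange_big; apply: eq_bigr => h _ /=.
rewrite [RHS](reindex_inj (mulgI h)); apply: eq_bigr => k _ /=.
by rewrite mulrA mulKg invMg !mulgA.
Qed.

Lemma galg_mul1x : left_id (gel 1) galg_mul.
Proof.
move=> x; apply/ffunP=> g; rewrite ffunE (bigD1 1%g) //= ffunE eqxx mul1r.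
rewrite invg1 mul1g big1 ?addr0 // => h /negbTE h1.
by rewrite ffunE h1 mul0r.
Qed.

Lemma galg_mulx1 : right_id (gel 1) galg_mul.
Proof.
move=> x; apply/ffunP=> g; rewrite ffunE (bigD1 g) //= ffunE mulVg eqxx mulr1.
rewrite big1 ?addr0 // => h /negbTE h1.
by rewrite ffunE -eq_mulVg1 h1 mulr0.
Qed.

Lemma galg_mulDl : left_distributive galg_mul +%R.
Proof.
move=> x y z; apply/ffunP=> g; rewrite !ffunE -big_split /=.
by apply: eq_bigr => h _; rewrite ffunE mulrDl.
Qed.

Lemma galg_mulDr : right_distributive galg_mul +%R.
Proof.
move=> x y z; apply/ffunP=> g; rewrite !ffunE -big_split /=.
by apply: eq_bigr => h _; rewrite ffunE mulrDr.
Qed.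

Lemma gel1_neq0 : gel 1 != 0.
Proof.
by apply/eqP => /ffunP/(_ 1%g); rewrite !ffunE eqxx => /eqP; rewrite oner_eq0.
Qed.

HB.instance Definition _ := GRing.Zmodule_isNzRing.Build galg
  galg_mulA galg_mul1x galg_mulx1 galg_mulDl galg_mulDr gel1_neq0.

Lemma galg_scaleAl (a : rat) x y : a *: (x * y) = (a *: x) * y.
Proof.
apply/ffunP=> g; rewrite !ffunE /= /GRing.scale /= mulr_sumr.
by apply: eq_bigr => h _; rewrite ffunE /GRing.scale /= mulrA.
Qed.

Lemma galg_scaleAr (a : rat) x y : a *: (x * y) = x * (a *: y).
Proof.
apply/ffunP=> g; rewrite !ffunE /= /GRing.scale /= mulr_sumr.
by apply: eq_bigr => h _; rewrite ffunE /GRing.scale /= mulrCA.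
Qed.

HB.instance Definition _ :=
  GRing.Lmodule_isLalgebra.Build rat galg galg_scaleAl.
HB.instance Definition _ :=
  GRing.Lalgebra_isAlgebra.Build rat galg galg_scaleAr.

Lemma galgM x y g : (x * y) g = \sum_h (x h : rat) * y (h^-1 * g)%g.
Proof. by rewrite ffunE. Qed.

Lemma galgE x : x = \sum_g (x g : rat) *: gel g.
Proof.
apply/ffunP=> h; rewrite sum_ffunE (bigD1 h) //= !ffunE eqxx /GRing.scale /=.
rewrite mulr1 big1 ?addr0 // => g /negbTE gh.
by rewrite !ffunE eq_sym gh /GRing.scale /= mulr0.
Qed.

Lemma gel_mull g x h : (gel g * x) h = x (g^-1 * h)%g.
Proof.
rewrite galgM (bigD1 g) //= ffunE eqxx mul1r big1 ?addr0 // => k /negbTE kg.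
by rewrite ffunE kg mul0r.
Qed.

Lemma gel_mulr g x h : (x * gel g) h = x (h * g^-1)%g.
Proof.
rewrite galgM (bigD1 (h * g^-1)%g) //= ffunE invMg invgK mulgKV eqxx mulr1.
rewrite big1 ?addr0 // => k kg; rewrite ffunE.
have [gE|] := eqVneq; last by rewrite mulr0.
by rewrite -gE invMg invgK mulKVg eqxx in kg.
Qed.

Lemma gelM g h : gel g * gel h = gel (g * h)%g.
Proof.
by apply/ffunP=> k; rewrite gel_mull !ffunE -(inj_eq (mulgI g)) mulKVg.
Qed.

Definition star x : galg := [ffun g => x g^-1%g].

Lemma starK : involutive star.
Proof. by move=> x; apply/ffunP=> g; rewrite !ffunE invgK. Qed.

Lemma starM x y : star (x * y) = star y * star x.
Proof.
apply/ffunP=> g; rewrite ffunE !galgM.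
rewrite [RHS](reindex_inj (mulgI g)); apply: eq_bigr => h _ /=.
by rewrite !ffunE !invMg !invgK mulKg mulrC.
Qed.

Lemma star0 : star 0 = 0.
Proof. by apply/ffunP=> g; rewrite !ffunE. Qed.

(* The coefficient of 1 in x^* x is the sum of the squares of the             *)
(* coefficients of x.                                                         *)
Lemma star_mul_eq0 x : star x * x = 0 -> x = 0.
Proof.
move/ffunP/(_ 1%g); rewrite galgM ffunE => /eqP.
under eq_bigr => h _ do rewrite ffunE mulg1.
rewrite psumr_eq0 => [|h _]; last exact: sqr_ge0.
move/allP=> x0; apply/ffunP=> g; have:= x0 g^-1%g (mem_index_enum _).
by rewrite /= invgK mulf_eq0 orbb ffunE => /eqP.
Qed.
End GroupAlgebra.

(** * Splitting a quasi-idempotent by positivity and a dimension count *)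

Section Decomposition.
Variables (gT : finGroupType) (e : galg gT) (N : rat) (L : finType).
Variables (a b : L -> galg gT) (U : {vspace galg gT}).
Hypotheses (N_neq0 : N != 0) (eM : e * e = N *: e).
Hypotheses (aS : forall l, star (a l) = a l) (bS : forall l, star (b l) = b l).
Hypothesis bM : forall l, exists beta : rat, b l * b l = beta *: b l.
Hypothesis abP : forall l x, exists k : rat, a l * x * b l = k *: (a l * b l).
Hypothesis ab0 : forall l m x, l != m -> a l * b l * x * (a m * b m) = 0.
Hypothesis eab : forall l, exists x, e * x * (a l * b l) != 0.
Hypotheses (eU : forall x, e * x * e \in U) (dimU : (\dim U <= #|L|)%N).

(* z = e x a b satisfies (a b) A z <> 0: otherwise w = z^* z = b a (...)      *)
(* would satisfy w^* w = 0.                                                   *)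
Lemma decomposition_pair l :
  exists xy : galg gT * galg gT,
    a l * b l * xy.2 * e * xy.1 * (a l * b l) = a l * b l.
Proof.
have [x xP] := eab l; set c := a l * b l in xP *; set z := e * x * c in xP.
have [bt bE] := bM l.
pose w := star x * star e * z.
have zz : star z * z = b l * a l * w.
  by rewrite /w /z /c !starM aS bS !mulrA.
have cw : c * (a l * w) != 0.
  apply: contraNneq xP => aba; apply/eqP; apply: star_mul_eq0.
  rewrite zz; move: (w) aba => v aba; apply: star_mul_eq0.
  rewrite !starM aS bS -!mulrA.
  have -> : b l * (b l * (a l * v)) = bt *: (b l * (a l * v)).
    by rewrite mulrA bE -scalerAl.
  by move: aba; rewrite /c -mulrA -!scalerAr => ->; rewrite !mulr0 scaler0.
pose y := a l * star x * star e.
have cyE : c * y * e * x * c = c * (a l * w) by rewrite /y /w /z !mulrA.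
have [k kE] := abP l (b l * y * e * x * a l).
have k0 : k != 0.
  apply: contraNneq cw => k0; rewrite -cyE.
  by move: kE; rewrite k0 scale0r /c -!mulrA => ->.
exists (x, k^-1 *: y) => /=; rewrite -/c.
rewrite -scalerAr -!scalerAl; apply: (scalerI k0).
by rewrite scalerA mulfV // scale1r -kE /c !mulrA.
Qed.

(* The elements p l are nonzero orthogonal idempotents up to the scalar N, so *)
(* they form a basis of U, on which the coordinates of e must be 1.           *)
Lemma decomposition :
  exists X Y : L -> galg gT,
    \sum_l e * X l * (a l * b l) * Y l * e = e /\
    forall l m, a l * b l * Y l * e * X m * (a m * b m) =
      if l == m then a l * b l else 0.
Proof.
have [XY XYP] := fin_all_exists decomposition_pair.
pose X l := (XY l).1; pose Y l := (XY l).2; pose c l := a l * b l.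
have cP l m : c l * Y l * e * X m * c m = if l == m then c l else 0.
  have [<-|lm] := eqVneq l m; first exact: XYP.
  by have:= ab0 (Y l * e * X m) lm; rewrite !mulrA.
pose p l := e * X l * c l * Y l * e.
have c0 l : c l != 0.
  by have [x] := eab l; apply: contraNneq; rewrite -/(c l) => ->; rewrite mulr0.
have pM l m : p l * p m = if l == m then N *: p l else 0.
  have -> : p l * p m = N *: (e * X l * (c l * Y l * e * X m * c m) * Y m * e).
    rewrite /p !mulrA -[_ * e * e]mulrA eM.
    by rewrite -!(scalerAr, scalerAl) ?mulrA.
  by rewrite cP; case: eqP => [<-|] //; rewrite ?mulr0 ?mul0r ?scaler0 // /p.
have p0 l : p l != 0.
  apply: contraNneq (c0 l) => pl.
  have : c l * Y l * p l * X l * c l = c l.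
    have -> : c l * Y l * p l * X l * c l =
       (c l * Y l * e * X l * c l) * Y l * e * X l * c l by rewrite /p !mulrA.
    by rewrite !cP eqxx cP eqxx.
  by rewrite pl mulr0 !mul0r => <-.
have eP l : e * p l = N *: p l by rewrite /p -!mulrA !(mulrA e e) eM -!scalerAl.
pose P := [tuple p (enum_val i) | i < #|L|].
have sumP (k : 'I_#|L| -> rat) l :
    (\sum_i k i *: P`_i) * p l = (k (enum_rank l) * N) *: p l.
  rewrite mulr_suml (bigD1 (enum_rank l)) //= -(tnth_nth 0 P) tnth_mktuple enum_rankK.
  rewrite -scalerAl pM eqxx scalerA big1 ?addr0 // => i il.
  rewrite -(tnth_nth 0 P) tnth_mktuple -scalerAl pM ifN ?scaler0 //.
  by apply: contraNneq il => <-; rewrite enum_valK.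
have freeP' : free P.
  apply/freeP => k k0 i; have:= sumP k (enum_val i).
  rewrite k0 mul0r enum_valK => /esym/eqP.
  by rewrite scaler_eq0 (negbTE (p0 _)) orbF mulf_eq0 (negbTE N_neq0) orbF => /eqP.
have spanP : <<P>>%VS = U.
  apply/eqP; rewrite eqEdim; apply/andP; split.
    apply/span_subvP => _ /tnthP[i ->]; rewrite tnth_mktuple.
    by have := eU (X (enum_val i) * c (enum_val i) * Y (enum_val i)); rewrite /p !mulrA.
  by move: freeP'; rewrite /free size_tuple => /eqP ->.
have einU : e \in <<P>>%VS.
  have -> : e = (N * N)^-1 *: (e * e * e).
    by rewrite eM -scalerAl eM !scalerA -!mulrA mulVf ?scale1r // mulf_neq0.
  by rewrite spanP memvZ.
exists X, Y; split=> //; rewrite [RHS](coord_span einU).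
rewrite [RHS](reindex (@enum_rank L)); last first.
  by exists enum_val => i _; rewrite ?enum_rankK ?enum_valK.
apply: eq_bigr => l _; rewrite -(tnth_nth 0 P) tnth_mktuple enum_rankK -[LHS]scale1r.
congr (_ *: _); apply: (mulIf N_neq0); rewrite mul1r.
have := sumP (fun i => coord P i e) l; rewrite -(coord_span einU) eP => /eqP.
by rewrite -subr_eq0 -scalerBl scaler_eq0 (negbTE (p0 l)) orbF subr_eq0 => /eqP.
Qed.
End Decomposition.

Section SignedSum.
Variables (gT : finGroupType) (G : {group gT}) (chi : gT -> bool).
Hypothesis chiM : {in G &, {morph chi : s t / (s * t)%g >-> s (+) t}}.

Definition signed_sum : galg gT := [ffun s => (s \in G)%:R * (-1) ^+ chi s].

Lemma chi1 : chi 1%g = false.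
Proof. by have := chiM (group1 G) (group1 G); rewrite mulg1; case: (chi _). Qed.

Lemma chiV s : s \in G -> chi s^-1%g = chi s.
Proof.
move=> sG; have := chiM sG (groupVr sG); rewrite mulgV chi1.
by case: (chi s); case: (chi _).
Qed.

Lemma signed_sumE : signed_sum = \sum_(s in G) (-1) ^+ chi s *: gel s.
Proof.
rewrite [LHS]galgE [RHS]big_mkcond; apply: eq_bigr => s _; rewrite ffunE.
by case: ifP => _; rewrite ?mul1r // mul0r scale0r.
Qed.

Lemma gel_signed_sum s : s \in G ->
  gel s * signed_sum = (-1) ^+ chi s *: signed_sum.
Proof.
move=> sG; apply/ffunP=> t; rewrite gel_mull !ffunE groupMl ?groupV //.
have [tG|] := boolP (t \in G); last by rewrite !mul0r scaler0.
by rewrite chiM ?groupV // chiV // signr_addb !mul1r.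
Qed.

Lemma signed_sum_gel s : s \in G ->
  signed_sum * gel s = (-1) ^+ chi s *: signed_sum.
Proof.
move=> sG; apply/ffunP=> t; rewrite gel_mulr !ffunE groupMr ?groupV //.
have [tG|] := boolP (t \in G); last by rewrite !mul0r scaler0.
by rewrite chiM ?groupV // chiV // signr_addb !mul1r mulrC.
Qed.

Lemma star_signed_sum : star signed_sum = signed_sum.
Proof.
apply/ffunP=> t; rewrite !ffunE groupV.
by have [tG|] := boolP (t \in G); rewrite ?mul0r // chiV.
Qed.

Lemma signed_sum_sqr : signed_sum * signed_sum = #|G|%:R *: signed_sum.
Proof.
rewrite {1}signed_sumE mulr_suml (eq_bigr (fun=> signed_sum)) => [|s sG].
  by rewrite sumr_const scaler_nat.
by rewrite -scalerAl gel_signed_sum // scalerA -signr_addb addbb scale1r.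
Qed.
End SignedSum.

Section FunStab.
Variables (T : finType).

Definition fun_stab (f : T -> nat) : {set {perm T}} :=
  [set s : {perm T} | [forall x, f (s x) == f x]].

Lemma fun_stabP f (s : {perm T}) :
  reflect (forall x, f (s x) = f x) (s \in fun_stab f).
Proof. by rewrite inE; apply: (iffP forallP) => fs x; apply/eqP. Qed.

Lemma fun_stab_group f : group_set (fun_stab f).
Proof.
apply/group_setP; split=> [|s t /fun_stabP sf /fun_stabP tf].
  by apply/fun_stabP=> x; rewrite perm1.
by apply/fun_stabP=> x; rewrite permM tf sf.
Qed.
Canonical fun_stab_groupType f := Group (fun_stab_group f).

Definition row_sum f := signed_sum (fun_stab f) (fun=> false).
Definition col_sum f := signed_sum (fun_stab f) (@odd_perm T).

Lemma odd_permM_in (G : {set {perm T}}) :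
  {in G &, {morph @odd_perm T : s t / (s * t)%g >-> s (+) t}}.
Proof. by move=> s t _ _; exact: odd_permM. Qed.
End FunStab.

(** * Young symmetrizers *)

Section Young.
Variables (T : finType).
Implicit Types (l : seq nat) (r c d : T -> nat) (g : {perm T}).

Lemma chi_false_morph (G : {set {perm T}}) :
  {in G &, {morph (fun=> false) : s t / (s * t)%g >-> s (+) t}}.
Proof. by []. Qed.

Lemma row_sum_gel r g : g \in fun_stab r -> row_sum r * gel g = row_sum r.
Proof.
by move=> gr; rewrite (signed_sum_gel (@chi_false_morph _)) ?expr0 ?scale1r.
Qed.

Lemma gel_col_sum c g : g \in fun_stab c ->
  gel g * col_sum c = (-1) ^+ odd_perm g *: col_sum c.
Proof. exact: gel_signed_sum (@odd_permM_in _ _) _. Qed.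

Lemma star_row_sum r : star (row_sum r) = row_sum r.
Proof. exact: star_signed_sum (@chi_false_morph _). Qed.

Lemma star_col_sum c : star (col_sum c) = col_sum c.
Proof. exact: star_signed_sum (@odd_permM_in _ _). Qed.

(** The transposition of x and y is absorbed by the row sum; moved across g it is a transposition
    within a column, absorbed with sign -1. So the product is its own negative. *)
Lemma row_col_vanish r c g x y : x != y -> r x = r y -> c (g x) = c (g y) ->
  row_sum r * gel g * col_sum c = 0.
Proof.
move=> xy rxy cxy; pose t := tperm x y.
have tr : t \in fun_stab r by apply/fun_stabP=> z; rewrite /t; case: tpermP => [->|->|].
have tc : tperm (g x) (g y) \in fun_stab c.
  by apply/fun_stabP=> z; case: tpermP => [->|->|].
have gt : gel t * gel g = gel g * gel (tperm (g x) (g y)) :> galg _.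
  by rewrite !gelM -tpermJ conjgE !mulgA mulgV mul1g.
suff E : row_sum r * gel g * col_sum c = - (row_sum r * gel g * col_sum c).
  have: (row_sum r * gel g * col_sum c) *+ 2 = 0 by rewrite mulr2n {1}E addNr.
  by rewrite -scaler_nat => /eqP; rewrite scaler_eq0 pnatr_eq0 => /eqP.
rewrite -{1}(row_sum_gel tr) -(mulrA (row_sum r)) gt mulrA -mulrA.
rewrite gel_col_sum // odd_tperm (inj_eq perm_inj) xy expr1 scaleN1r mulrN.
by [].
Qed.

Lemma linear_gel (P : galg {perm T} -> Prop) :
  P 0 -> (forall k x y, P x -> P y -> P (k *: x + y)) ->
  (forall g, P (gel g)) -> forall x, P x.
Proof.
move=> P0 PD Pg x; rewrite [x]galgE; apply: big_ind => // [y z Py Pz|g _].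
  by rewrite -[y]scale1r; apply: PD.
by rewrite -[_ *: _]addr0; apply: PD.
Qed.

Lemma row_colP r c g :
  (exists x y, [/\ x != y, r x = r y & c (g x) = c (g y)]) \/
  (forall x y, r x = r y -> c (g x) = c (g y) -> x = y).
Proof.
have [/existsP[x /existsP[y /and3P[xy /eqP rE /eqP cE]]]|H] := boolP
  [exists x, [exists y, [&& x != y, r x == r y & c (g x) == c (g y)]]].
  by left; exists x, y.
right=> x y rE cE; apply/eqP; apply: contraNT H => xy.
by apply/existsP; exists x; apply/existsP; exists y; rewrite xy rE cE !eqxx.
Qed.

(** Von Neumann's lemma. If g sends no two entries of a row to one column, then [tableau_col_bound]
    makes c (g x) number the entries of each row, and g is a row permutation p times a column
    permutation. *)
Lemma row_col_scalar l r c x : tableau l r c ->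
  exists k : rat, row_sum r * x * col_sum c = k *: (row_sum r * col_sum c).
Proof.
move=> tab; elim/linear_gel: x => [|k x y [kx xE] [ky yE]|g].
- by exists 0; rewrite mulr0 mul0r scale0r.
- exists (k * kx + ky); rewrite mulrDr mulrDl -scalerAr -scalerAl xE yE.
  by rewrite scalerA scalerDl.
have [[x [y [xy rE cE]]]|inj] := row_colP r c g.
  by exists 0; rewrite (row_col_vanish xy) ?scale0r.
have bd : forall x, (c (g x) < nth 0 l (r x))%N.
  apply: (tableau_col_bound tab) => //=.
  by rewrite [leqRHS](reindex_inj (@perm_inj _ g)).
have [p pP] := tableau_perm tab inj bd.
have pr : p \in fun_stab r by apply/fun_stabP=> x; case: (pP x).
have qc : (p^-1 * g)%g \in fun_stab c.
  apply/fun_stabP=> x; rewrite permM; have [_ <-] := pP (p^-1 x)%g.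
  by rewrite permKV.
exists ((-1) ^+ odd_perm (p^-1 * g)%g).
rewrite -{1}(mulKVg p g) -gelM mulrA row_sum_gel // -mulrA gel_col_sum //.
by rewrite -scalerAr.
Qed.

(** If g is not killed by a transposition, the column bound yields a permutation matching the
    columns of the two tableaux, so the shapes have equal column lengths. *)
Lemma row_col_vanish_shape l r c l' r' c' x :
  is_partition l -> is_partition l' -> tableau l r c -> tableau l' r' c' ->
  l != l' -> (\sum_x c' x <= \sum_x c x)%N -> row_sum r * x * col_sum c' = 0.
Proof.
move=> lP lP' tab tab' ll le_c; elim/linear_gel: x => [|k x y xE yE|g].
- by rewrite mulr0 mul0r.
- by rewrite mulrDr mulrDl -scalerAr -scalerAl xE yE scaler0 addr0.
have [[x [y [xy rE cE]]]|inj] := row_colP r c' g.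
  by rewrite (row_col_vanish xy).
have bd : forall x, (c' (g x) < nth 0 l (r x))%N.
  apply: (tableau_col_bound tab) => //=.
  by move: le_c; rewrite (reindex_inj (@perm_inj _ g)).

have [p pP] := tableau_perm tab inj bd.
case/eqP: ll; apply: partition_eq_count => // j.
rewrite -(card_tableau_col _ tab) -(card_tableau_col _ tab').
rewrite -(card_preimset _ (@perm_inj _ (g^-1 * p)%g)).
apply: eq_card => x; rewrite !inE permM; have [_ ->] := pP (g^-1 x)%g.
by rewrite permKV.
Qed.

(** The column totals of the two tableaux are always comparable. One order kills the factor between
    the row sum of r and the column sum of c'; in the other order [star] gives the vanishing between
    the column sum of c and the row sum of r'. *)
Lemma young_orthogonal l r c l' r' c' x :
  is_partition l -> is_partition l' -> tableau l r c -> tableau l' r' c' ->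
  l != l' -> row_sum r * col_sum c * x * (row_sum r' * col_sum c') = 0.
Proof.
move=> lP lP' tab tab' ll; have [le_c|/ltnW le_c] := leqP (\sum_x c' x) (\sum_x c x).
  have := row_col_vanish_shape (col_sum c * x * row_sum r') lP lP' tab tab' ll le_c.
  by rewrite !mulrA.
rewrite eq_sym in ll.
have := row_col_vanish_shape (star x) lP' lP tab' tab ll le_c.
move/(congr1 (@star _)); rewrite !starM starK star0.
rewrite !star_row_sum !star_col_sum => E.
have -> : row_sum r * col_sum c * x * (row_sum r' * col_sum c') =
  row_sum r * (col_sum c * (x * row_sum r')) * col_sum c' by rewrite !mulrA.
by rewrite E mulr0 mul0r.
Qed.
End Young.

(** * The signed centralizer of an involution *)

Section OddExtension.
Variables (S T : finType) (eta : S -> T).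
Hypothesis eta_inj : injective eta.

Lemma odd_perm_extension (s : {perm S}) (u : {perm T}) :
  (forall a, u (eta a) = eta (s a)) ->
  (forall x, x \notin codom eta -> u x = x) -> odd_perm u = odd_perm s.
Proof.
have [ts -> _] := prod_tpermP s => uE uN.
pose U (ts : seq (S * S)) := (\prod_(t <- ts) tperm (eta t.1) (eta t.2))%g.
suff [E N O] : [/\ forall a, U ts (eta a) = eta ((\prod_(t <- ts) tperm t.1 t.2)%g a),
    forall x, x \notin codom eta -> U ts x = x &
    odd_perm (U ts) = odd_perm (\prod_(t <- ts) tperm t.1 t.2)%g].
  rewrite -O; congr odd_perm; apply/permP => x.
  have [/codomP[a ->]|xN] := boolP (x \in codom eta); first by rewrite uE E.
  by rewrite uN ?N.
rewrite /U; elim: ts {uE} => [|[a b] ts [E N O]].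
  by split=> [a|x _|]; rewrite !big_nil ?perm1 ?odd_perm1.
split=> [z|x xN|]; rewrite !big_cons ?odd_permM ?odd_tperm ?permM /=.
- by rewrite -(inj_tperm _ _ _ eta_inj) E.
- rewrite tpermD ?N //; apply: contraNneq xN => <-; exact: codom_f.
by rewrite O (inj_eq eta_inj).
Qed.
End OddExtension.

Lemma if_perm_inj (T : finType) (P : pred T) (u : {perm T}) :
  (forall x, P (u x) = P x) -> injective (fun x => if P x then u x else x).
Proof.
move=> Pu x y; case: ifP => Px; case: ifP => Py.
- exact: perm_inj.
- by move=> xy; rewrite -Pu xy Py in Px.
- by move=> xy; rewrite -Pu -xy Px in Py.
by [].
Qed.

Section Compatible.
Variables (S T : finType) (iota : {perm T}) (eta : S -> T).
Hypothesis iotaK : forall x, iota (iota x) = x.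
Hypothesis eta_inj : injective eta.
Hypothesis etaP : forall x, (iota x == x) = (x \in codom eta).

Definition compatible (s : {perm S}) (h : {perm T}) : bool :=
  (h \in 'C[iota]%g) && [forall a, h (eta a) == eta (s a)].

Lemma cent_permP (h : {perm T}) :
  reflect (forall x, h (iota x) = iota (h x)) (h \in 'C[iota]%g).
Proof.
apply: (iffP cent1P) => [E x|E].
  by have /permP/(_ x) := E; rewrite !permM.
by apply/permP=> x; rewrite !permM E.
Qed.

Lemma compatibleP (s : {perm S}) (h : {perm T}) :
  reflect ((forall x, h (iota x) = iota (h x)) /\ (forall a, h (eta a) = eta (s a)))
    (compatible s h).
Proof.
apply: (iffP andP) => [[/cent_permP hi /forallP he]|[hi he]].
  by split=> // a; apply/eqP.
by split; [apply/cent_permP|apply/forallP => a; apply/eqP].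
Qed.

Lemma compatible_uniq s s' h : compatible s h -> compatible s' h -> s = s'.
Proof.
move=> /compatibleP[_ E] /compatibleP[_ E']; apply/permP=> a.
by apply: eta_inj; rewrite -E -E'.
Qed.

Lemma compatible_ex h : h \in 'C[iota]%g -> exists s, compatible s h.
Proof.
move=> hC; have /cent_permP hi := hC.
have /fin_all_exists[f fP] a : exists b, h (eta a) = eta b.
  apply/codomP; rewrite -etaP -hi; have : iota (eta a) == eta a.
    by rewrite etaP codom_f.
  by move/eqP => ->.
have f_inj : injective f.
  by move=> a b fab; apply/eta_inj/(@perm_inj _ h); rewrite !fP fab.
exists (perm f_inj); rewrite /compatible hC; apply/forallP=> a.
by rewrite permE fP.
Qed.

Lemma compatibleM s t h k :
  compatible s h -> compatible t k -> compatible (s * t) (h * k).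
Proof.
move=> /andP[hC /forallP hE] /andP[kC /forallP kE].
rewrite /compatible groupM //; apply/forallP => a.
by rewrite !permM (eqP (hE a)) (eqP (kE _)).
Qed.

(** The sign of h on the fixed points of iota. For h in the centralizer exactly one s is compatible,
    so the existential just reads off its parity. *)
Definition fix_sign (h : {perm T}) : bool :=
  [exists s, compatible s h && odd_perm s].

Lemma fix_signE s h : compatible s h -> fix_sign h = odd_perm s.
Proof.
move=> sh; apply/existsP/idP => [[t /andP[th]]|os]; last by exists s; rewrite sh.
by rewrite (compatible_uniq sh th).
Qed.

Lemma fix_signM :
  {in 'C[iota]%g &, {morph fix_sign : s t / (s * t)%g >-> s (+) t}}.
Proof.
move=> h k /compatible_ex[s sh] /compatible_ex[t tk].
by rewrite (fix_signE (compatibleM sh tk)) odd_permM (fix_signE sh) (fix_signE tk).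
Qed.

Definition fix_sum : galg {perm T} := signed_sum 'C[iota]%G fix_sign.

Lemma fix_sum_sqr : fix_sum * fix_sum = #|'C[iota]%g|%:R *: fix_sum.
Proof. exact: signed_sum_sqr fix_signM. Qed.

Lemma gel_fix_sum h : h \in 'C[iota]%g ->
  gel h * fix_sum = (-1) ^+ fix_sign h *: fix_sum.
Proof. exact: gel_signed_sum fix_signM _. Qed.

Lemma fix_sum_gel h : h \in 'C[iota]%g ->
  fix_sum * gel h = (-1) ^+ fix_sign h *: fix_sum.
Proof. exact: signed_sum_gel fix_signM _. Qed.

(** Up to sign, e g e depends only on the double coset of g modulo the centralizer of iota. *)
Lemma fix_sum_translate g g' h k : h \in 'C[iota]%g -> k \in 'C[iota]%g ->
  (h * g = g' * k)%g ->
  fix_sum * gel g * fix_sum =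
  (-1) ^+ (fix_sign h (+) fix_sign k) *: (fix_sum * gel g' * fix_sum).
Proof.
move=> hC kC E.
have : fix_sum * gel h * gel g * fix_sum = fix_sum * gel g' * (gel k * fix_sum).
  by rewrite mulrA -!(mulrA fix_sum) !gelM E.
rewrite gel_fix_sum // fix_sum_gel // -scalerAr -!scalerAl => {}E.
by rewrite signr_addb -scalerA -E scalerA -signr_addb addbb scale1r.
Qed.

Lemma fix_sum_vanish g h k : h \in 'C[iota]%g -> k \in 'C[iota]%g ->
  (h * g = g * k)%g -> fix_sign h != fix_sign k -> fix_sum * gel g * fix_sum = 0.
Proof.
move=> hC kC E hk; have := fix_sum_translate hC kC E.
set x := _ * _ * _; have -> : fix_sign h (+) fix_sign k = true.
  by move: hk; do 2!case: fix_sign.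
rewrite expr1 scaleN1r => xN; apply/eqP.
have : x *+ 2 == 0 by rewrite mulr2n {1}xN addNr.
by rewrite -scaler_nat scaler_eq0 pnatr_eq0.
Qed.

Section Adapted.
Variables (l : seq nat) (r c : T -> nat).
Hypotheses (tab : tableau l r c) (rI : forall x, r (iota x) = r x).
Hypothesis cI : forall x, c (iota x) = domino (nth 0%N l (r x)) (c x).

Let fixP := adapted_fix tab rI cI.

Let odd_iota x : iota x != x -> odd (c (iota x)) = ~~ odd (c x).
Proof.
have [_ bd _] := tab; rewrite fixP cI /domino; case: ifP => [o _|o /= n1].
  by move: o; case: (c x) => // k /= /negbTE.
by rewrite ltn_neqAle eq_sym n1 bd /= o.
Qed.

(* u = h p preserves columns and, like h, maps dominoes to dominoes. Its      *)
(* actions on the odd columns and on the rest of the dominoes are conjugate   *)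
(* by iota, so only the fixed points contribute to its sign.                  *)
Lemma adapted_odd_perm (h p : {perm T}) : h \in 'C[iota]%g ->
  p \in fun_stab r -> (h * p)%g \in fun_stab c ->
  odd_perm (h * p)%g = fix_sign h.
Proof.
have [inj bd _] := tab.
move=> hC /fun_stabP pr; set u := (h * p)%g => /fun_stabP uc.
have ru x : r (u x) = r (h x) by rewrite permM pr.
clearbody u.
have ruI x : r (u (iota x)) = r (u x).
  by rewrite !ru; have /cent_permP -> := hC; rewrite rI.
have uI0 x : iota x != x -> u (iota x) = iota (u x).
  move=> ix; apply: inj; first by rewrite ruI rI.
  rewrite uc !cI uc /domino; case: ifP => // c0.
  have := ix; rewrite fixP c0 /= => nx.
  have cx : ((c x).+1 < nth 0 l (r x))%N by rewrite ltn_neqAle eq_sym nx bd.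
  rewrite cx; have := bd (u (iota x)); rewrite uc cI /domino c0 cx ruI => ->.
  by [].
have uI x : u (iota x) = iota (u x).
  have [ix|] := boolP (iota x == x); last exact: uI0.
  rewrite (eqP ix); apply/esym/eqP; apply: contraT => uix.
  (* Suppose that u x is not fixed although x is. Its partner lies in an odd column, hence is the
     image of a point y that is not fixed; the previous case gives u (iota y) = u x, so y = x, a
     contradiction. *)
  have ow : odd (c (u^-1 (iota (u x)))%g).
    rewrite -uc permKV odd_iota // uc.
    by move: ix; rewrite fixP => /andP[].
  have /uI0 : iota (u^-1 (iota (u x)))%g != (u^-1 (iota (u x)))%g.
    by rewrite fixP ow.
  rewrite permKV iotaK => /perm_inj/(congr1 iota); rewrite iotaK (eqP ix).
  by move/(congr1 u); rewrite permKV => E; rewrite E eqxx in uix.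
have uC : u \in 'C[iota]%g by apply/cent_permP.
have [s hs] := compatible_ex hC; have [_ hE] := compatibleP _ _ hs.
have fixE x : iota x = x -> nth 0%N l (r x) = (c x).+1.
  by move/eqP; rewrite fixP => /andP[_ /eqP].
have etaI a : iota (eta a) = eta a by apply/eqP; rewrite etaP codom_f.
have uE a : u (eta a) = eta (s a).
  have rE : r (u (eta a)) = r (eta (s a)) by rewrite ru hE.
  apply: inj => //; apply: succn_inj; rewrite -!fixE ?rE //.
  by rewrite -uI etaI.
rewrite (fix_signE hs).
have uO_inj : injective (fun x => if odd (c x) then u x else x).
  by apply: if_perm_inj => x; rewrite uc.
have uF_inj : injective (fun x => if iota x == x then u x else x).
  by apply: if_perm_inj => x; rewrite -uI (inj_eq perm_inj).
pose uO := perm uO_inj; pose uF := perm uF_inj.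
(* uF moves the fixed points, uO the odd columns, and the conjugate of uO by iota their partners. In
   the sign uO and iota occur twice, so only uF remains. *)
have -> : u = (uF * uO * (iota * uO * iota))%g.
  apply/permP=> x; rewrite !permM !(permE uF_inj).
  have [ix|ix] := eqVneq (iota x) x.
    have o0 : odd (c (u x)) = false.
      by have /eqP := ix; rewrite fixP uc => /andP[/negbTE].
    have uix : iota (u x) = u x by rewrite -uI ix.
    by rewrite !permE o0 uix o0 uix.
  have uix : iota (u x) != u x by rewrite -uI (inj_eq perm_inj).
  rewrite [uO x]permE; case: ifP => ox.
    by rewrite permE odd_iota // uc ox /= iotaK.
  by rewrite permE odd_iota // ox /= uI iotaK.
rewrite !odd_permM.
rewrite -(@odd_perm_extension _ _ _ eta_inj s uF).
- by case: (odd_perm iota) (odd_perm uO) (odd_perm uF) => -[] [].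
- by move=> a; rewrite permE etaP codom_f uE.
by move=> x; rewrite -etaP permE => /negbTE ->.
Qed.

(** A term h p q contributes to the coefficient of 1 only if h p is the inverse of q and so
    preserves columns. By [adapted_odd_perm] the signs of h and q then cancel, and h = p = 1
    contributes 1. *)
Lemma fix_sum_row_col_neq0 : fix_sum * (row_sum r * col_sum c) != 0.
Proof.
apply/eqP => /ffunP/(_ 1%g); apply/eqP; rewrite galgM [in X in _ != X]ffunE.
rewrite gt_eqF //.
have ge0 h p : 0 <= (fix_sum h : rat) *
    ((row_sum r p : rat) * col_sum c (p^-1 * (h^-1 * 1))%g).
  rewrite mulg1 -invMg !ffunE; case: (boolP (h \in _)) => [hC|]; last by rewrite !mul0r.
  case: (boolP (p \in _)) => [pr|]; last by rewrite !(mul0r, mulr0).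
  case: (boolP (_ \in fun_stab c)) => [|_]; last by rewrite !(mul0r, mulr0).
  rewrite groupV => hpc; rewrite odd_permV (adapted_odd_perm hC pr hpc).
  by rewrite !mul1r -signr_addb addbb.
have lower : (1 : rat) <= \sum_p (fix_sum 1%g : rat) *
    ((row_sum r p : rat) * col_sum c (p^-1 * (1^-1 * 1))%g).
  rewrite (bigD1 1%g) //= ler_wpDr ?sumr_ge0 //.
  rewrite !(mulg1, invg1) !ffunE !group1 odd_perm1 /= (chi1 (G := 'C[iota]%G)) //.
  exact: fix_signM.
apply: lt_le_trans ltr01 _; apply: le_trans lower _.
rewrite [leRHS](bigD1 1%g) //= galgM mulr_sumr lerDl sumr_ge0 // => h _.
by rewrite galgM mulr_sumr sumr_ge0.
Qed.
End Adapted.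
End Compatible.

(** * Double cosets *)

Section DoubleCosets.
Variables (S T : finType) (iota : {perm T}) (eta : S -> T).
Hypothesis iotaK : forall x, iota (iota x) = x.
Hypothesis eta_inj : injective eta.
Hypothesis etaP : forall x, (iota x == x) = (x \in codom eta).
Local Notation e := (fix_sum iota eta).

Lemma iota_eta a : iota (eta a) = eta a.
Proof. by apply/eqP; rewrite etaP codom_f. Qed.

Lemma card_iota_fix : #|[set x | iota x == x]| = #|S|.
Proof.
by rewrite -(card_codom eta_inj); apply: eq_card => x; rewrite inE etaP.
Qed.

Definition conj_iota (g : {perm T}) : {perm T} := (g^-1 * iota * g)%g.

Lemma conj_iotaE g x : conj_iota g (g x) = g (iota x).
Proof. by rewrite !permM permK. Qed.

Lemma conj_iotaK g : involutive (conj_iota g).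
Proof. by move=> x; rewrite -[x](permKV g) !conj_iotaE iotaK. Qed.

Lemma conj_compatible g (h : {perm T}) (s : {perm S}) :
  (forall x, h (conj_iota g x) = conj_iota g (h x)) ->
  (forall a, h (g (eta a)) = g (eta (s a))) ->
  compatible iota eta s (g * h * g^-1)%g.
Proof.
move=> hj he; apply/compatibleP; split=> [x|a]; rewrite !permM.
  by rewrite -conj_iotaE hj -{1}[h (g x)](permKV g) conj_iotaE permK.
by rewrite he permK.
Qed.

(** The swap h commutes with both involutions, so h and g h g^-1 centralize iota. On the fixed
    points of iota one of them acts trivially and the other by a transposition, so their signs
    differ. *)
Lemma fix_swap_vanish g : fix_swap iota (conj_iota g) \/ fix_swap (conj_iota g) iota ->
  e * gel g * e = 0.
Proof.
have fixg a : conj_iota g (g (eta a)) = g (eta a) by rewrite conj_iotaE iota_eta.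
case=> -[h [z [z' [[zz' jz jz'] [hi hj] h1 ht]]]].
  have /codomP[a aE] : (g^-1 z)%g \in codom eta.
    by rewrite -etaP -(inj_eq (@perm_inj _ g)) -conj_iotaE permKV jz.
  have /codomP[a' aE'] : (g^-1 z')%g \in codom eta.
    by rewrite -etaP -(inj_eq (@perm_inj _ g)) -conj_iotaE permKV jz'.
  have zE : z = g (eta a) by rewrite -aE permKV.
  have zE' : z' = g (eta a') by rewrite -aE' permKV.
  have ch : compatible iota eta 1 h.
    by apply/compatibleP; split=> // b; rewrite h1 ?iota_eta // perm1.
  have ck : compatible iota eta (tperm a a') (g * h * g^-1).
    apply: conj_compatible => // b; rewrite ht ?fixg // zE zE'.
    by rewrite -(inj_tperm _ _ _ (inj_comp (@perm_inj _ g) eta_inj)).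
  have [hC _] := andP ch; have [kC _] := andP ck.
  apply: (fix_sum_vanish eta_inj etaP kC hC); first by rewrite mulgKV.
  rewrite (fix_signE eta_inj ch) (fix_signE eta_inj ck) odd_tperm odd_perm1.
  by have [aa|//] := eqVneq a a'; rewrite zE zE' aa eqxx in zz'.
have /codomP[a aE] : z \in codom eta by rewrite -etaP jz.
have /codomP[a' aE'] : z' \in codom eta by rewrite -etaP jz'.
have ch : compatible iota eta (tperm a a') h.
  apply/compatibleP; split=> // b; rewrite ht ?iota_eta // aE aE'.
  by rewrite -(inj_tperm _ _ _ eta_inj).
have ck : compatible iota eta 1 (g * h * g^-1).
  by apply: conj_compatible => // b; rewrite perm1 h1 ?fixg.
have [hC _] := andP ch; have [kC _] := andP ck.
apply: (fix_sum_vanish eta_inj etaP kC hC); first by rewrite mulgKV.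
rewrite (fix_signE eta_inj ch) (fix_signE eta_inj ck) odd_tperm odd_perm1.
by have [aa|//] := eqVneq a a'; rewrite aE aE' aa eqxx in zz'.
Qed.

(** The normal form of [glue_tableau] for iota and its conjugate; l lists the orbit sizes. *)
Definition has_type (l : seq nat) (g : {perm T}) : Prop := exists r c,
  [/\ tableau l r c, forall x, r (iota x) = r x /\ r (conj_iota g x) = r x,
    forall x, c (iota x) = domino (nth 0%N l (r x)) (c x) &
    forall x, c (conj_iota g x) = shifted_domino (nth 0%N l (r x)) (c x)].

(** Equal types make the two pairs of involutions simultaneously conjugate by some p; then p and g'
    p g^-1 centralize iota, so g and g' share a double coset. *)
Lemma same_type_eq l g g' : has_type l g -> has_type l g' ->
  exists k : rat, e * gel g * e = k *: (e * gel g' * e).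
Proof.
move=> [r [c [tab rI cI cJ]]] [r' [c' [tab' rI' cI' cJ']]].
have [inj bd _] := tab; have [inj' _ _] := tab'.
have [p pP] := tableau_perm tab inj' (fun x => let: And3 _ H _ := tab' in H x).
have rp x : r (p x) = r' x by case: (pP x).
have cp x : c (p x) = c' x by case: (pP x).
have pI x : p (iota x) = iota (p x).
  apply: inj; first by rewrite rp (rI' x).1 (rI _).1 rp.
  by rewrite cp cI' cI rp cp.
have pJ x : p (conj_iota g' x) = conj_iota g (p x).
  apply: inj; first by rewrite rp (rI' x).2 (rI _).2 rp.
  by rewrite cp cJ' cJ rp cp.
have pC : p \in 'C[iota]%g by apply/cent_permP.
have kC : (g' * p * g^-1)%g \in 'C[iota]%g.
  apply/cent_permP => x; rewrite !permM -conj_iotaE pJ.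
  by rewrite -{1}[p (g' x)](permKV g) conj_iotaE permK.
eexists; apply: (fix_sum_translate eta_inj etaP kC pC).
by rewrite mulgKV.
Qed.

Variables (L : finType) (shape : L -> seq nat).
Hypothesis shape_inj : injective shape.
Hypothesis shapeP : forall l,
  [/\ is_partition (shape l), sumn (shape l) = #|T| & count odd (shape l) = #|S|].
Hypothesis shape_ex : forall p,
  is_partition p -> sumn p = #|T| -> count odd p = #|S| -> exists l, p = shape l.

(** One e g e per shape spans. A type has as many odd parts as iota has fixed points, so only shapes
    indexed by L occur. *)
Lemma double_coset_space : exists U : {vspace galg {perm T}},
  (\dim U <= #|L|)%N /\ forall x, e * x * e \in U.
Proof.
have rep l : exists g0, forall g, has_type (shape l) g ->
    exists k : rat, e * gel g * e = k *: (e * gel g0 * e).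
  have [[g0 g0l]|nog] := pselect (exists g, has_type (shape l) g).
    by exists g0 => g gl; apply: same_type_eq gl g0l.
  (* A shape that is the type of no g gets an arbitrary representative. *)
  by exists 1%g => g gl; case: nog; exists g.
have [g0 g0P] := choice rep.
pose B := [seq e * gel (g0 l) * e | l : L].
exists <<B>>%VS; split.
  by apply: leq_trans (dim_span _) _; rewrite size_map cardE.
move=> x; elim/linear_gel: x => [|k x y xU yU|g].
- by rewrite mulr0 mul0r mem0v.
- by rewrite mulrDr mulrDl -scalerAr -scalerAl memvD // memvZ.
have jK := conj_iotaK g.
have [ij|ji|[l [r [c [lP tab rI cI cJ]]]]] := glue_tableau iotaK jK.
- by rewrite fix_swap_vanish ?mem0v //; left.
- by rewrite fix_swap_vanish ?mem0v //; right.
have [||l' lE] := shape_ex lP; first by case: tab.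
  by rewrite -(card_adapted_fix tab (fun x => (rI x).1) cI) card_iota_fix.
have [|k ->] := g0P l' g; first by exists r, c; rewrite -lE.
by apply/memvZ/memv_span/imageP; exists l'.
Qed.

Lemma fix_sum_decomposition : exists (r c : L -> T -> nat) (X Y : L -> galg {perm T}),
  [/\ forall l, tableau (shape l) (r l) (c l),
    \sum_l e * X l * (row_sum (r l) * col_sum (c l)) * Y l * e = e &
    forall l m, row_sum (r l) * col_sum (c l) * Y l * e * X m *
        (row_sum (r m) * col_sum (c m)) =
      if l == m then row_sum (r l) * col_sum (c l) else 0].
Proof.
have adapted l : exists rc : (T -> nat) * (T -> nat),
    [/\ tableau (shape l) rc.1 rc.2, forall x, rc.1 (iota x) = rc.1 x &
    forall x, rc.2 (iota x) = domino (nth 0%N (shape l) (rc.1 x)) (rc.2 x)].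
  have [_ sz od] := shapeP l.
  have [|r [c rcP]] := adapted_tableau_ex iotaK sz; last by exists (r, c).
  by rewrite card_iota_fix od.
have [rc rcP] := choice adapted.
have [U [dimU eU]] := double_coset_space.
have [||||||||X [Y [XY YX]]] := @decomposition _ e #|'C[iota]%g|%:R L
  (fun l => row_sum (rc l).1) (fun l => col_sum (rc l).2) U _ _ _ _ _ _ _ _ eU dimU.
- by rewrite pnatr_eq0 -lt0n; apply: (cardG_gt0 'C[iota]%G).
- exact: fix_sum_sqr.
- by move=> l; apply: star_row_sum.
- by move=> l; apply: star_col_sum.
- by move=> l; eexists; apply: signed_sum_sqr (@odd_permM_in _ _).
- by move=> l x; have [tab _ _] := rcP l; apply: row_col_scalar tab.
- move=> l m x lm; have [tab _ _] := rcP l; have [tab' _ _] := rcP m.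
  have [lP _ _] := shapeP l; have [mP _ _] := shapeP m.
  by apply: (young_orthogonal x lP mP tab tab'); rewrite (inj_eq shape_inj).
- move=> l; exists 1; rewrite mulr1; have [tab rI cI] := rcP l.
  exact: fix_sum_row_col_neq0 tab rI cI.
exists (fun l => (rc l).1), (fun l => (rc l).2), X, Y; split=> // l.
by case: (rcP l).
Qed.
End DoubleCosets.

(** * Action on tensors *)

Section RatInChar0.
Variables (K : fieldType) (charK : [pchar K] =i pred0).

Lemma intr_pchar0_eq0 (z : int) : (z%:~R == 0 :> K) = (z == 0).
Proof.
have nat0 := (pcharf0P K).1 charK.
by case: z => n; rewrite ?NegzE ?rmorphN ?oppr_eq0 /= -?pmulrn ?nat0.
Qed.

(** Evaluates [ratr] on a fraction that need not be reduced; sums and products of rationals lead to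
    such fractions. *)
Lemma ratr_fraction (x : rat) (n d : int) :
  d != 0 -> x * d%:~R = n%:~R -> @ratr K x * d%:~R = n%:~R.
Proof.
move=> d0 xd.
have den0 : (denq x)%:~R != 0 :> K by rewrite intr_pchar0_eq0 denq_neq0.
have E : numq x * d = n * denq x.
  apply: (@intr_inj rat); rewrite !rmorphM /= -xd numqE.
  by rewrite mulrAC.
by rewrite /ratr mulrAC -rmorphM E rmorphM mulfK.
Qed.

Let ratr_den x : @ratr K x * (denq x)%:~R = (numq x)%:~R.
Proof. by apply: ratr_fraction; rewrite ?denq_neq0 ?numqE. Qed.

Lemma ratr_pchar0D (x y : rat) : @ratr K (x + y) = @ratr K x + @ratr K y.
Proof.
have d0 : denq x * denq y != 0 by rewrite mulf_neq0 ?denq_neq0.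
have dK0 : (denq x * denq y)%:~R != 0 :> K by rewrite intr_pchar0_eq0.
apply: (mulIf dK0).
rewrite (@ratr_fraction _ (numq x * denq y + numq y * denq x)) //.
  rewrite mulrDl !rmorphD !rmorphM /= -!ratr_den mulrA; congr (_ + _).
  by rewrite mulrA mulrAC.
rewrite mulrDl !rmorphD !rmorphM /= !numqE mulrA; congr (_ + _).
by rewrite mulrA mulrAC.
Qed.

Lemma ratr_pchar0M (x y : rat) : @ratr K (x * y) = @ratr K x * @ratr K y.
Proof.
have d0 : denq x * denq y != 0 by rewrite mulf_neq0 ?denq_neq0.
have dK0 : (denq x * denq y)%:~R != 0 :> K by rewrite intr_pchar0_eq0.
apply: (mulIf dK0); rewrite (@ratr_fraction _ (numq x * numq y)) //.
  by rewrite !rmorphM /= -!ratr_den mulrACA.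
by rewrite !rmorphM /= !numqE mulrACA.
Qed.

Lemma ratr_sign n : @ratr K ((-1) ^+ n) = (-1) ^+ n.
Proof.
rewrite -signr_odd -[RHS]signr_odd.
by case: odd; rewrite ?(ratr_int K (-1)) ?(ratr_nat K 1).
Qed.
End RatInChar0.

Lemma linear_packed (K : fieldType) (A B : lmodType K) (f : A -> B) :
  linear f -> exists F : {linear A -> B}, F =1 f.
Proof.
move=> fL; pose L := GRing.isLinear.Build K A B _ f fL.
by pose F : {linear A -> B} := HB.pack f L; exists F.
Qed.

Section Lifts.
Variables (K : fieldType).

Lemma lquot_lift (F M : lmodType K) (R : F -> Prop) (f : {linear F -> M}) :
  (forall x, R x -> f x = 0) ->
  exists g : {linear lquot R -> M}, forall x, g (lproj R x) = f x.
Proof.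
move=> fR.
have gE x : f (lrepr (lproj R x)) = f x.
  apply/eqP; rewrite -subr_eq0 -linearB.
  have /asboolP[s [sR ->]] : lrepr (lproj R x) - x \in lspan R.
    by apply/lproj_eq; rewrite lreprK.
  rewrite linear_sum big_seq big1 // => p ps.
  by rewrite linearZ /= (fR _ (sR p ps)) scaler0.
have gL : linear (fun x : lquot R => f (lrepr x)).
  move=> a x y; rewrite -[x]lreprK -[y]lreprK -linearP !gE.
  by rewrite linearP.
have [g gg] := linear_packed gL; exists g => x.
by rewrite gg gE.
Qed.

Lemma tensor_lift (V : lmodType K) (I : finType) (M : lmodType K)
    (h : {ffun I -> V} -> M) :
  (forall c i a x y, h (update c i (a *: x + y)) =
     a *: h (update c i x) + h (update c i y)) ->
  exists g : {linear tensor V I -> M}, forall c, g (pure_tensor c) = h c.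
Proof.
move=> hm.
have [|g gE] := @lquot_lift _ M (@tensor_rel K V I) (free_lift h).
  move=> _ [c [i [a [x [y ->]]]]]; rewrite /= free_lift_rel hm.
  by rewrite subrr.
by exists g => c; rewrite gE /= free_liftU.
Qed.

Lemma tensor_ext (V : lmodType K) (I : finType) (M : lmodType K)
    (f g : {linear tensor V I -> M}) :
  (forall c, f (pure_tensor c) = g (pure_tensor c)) -> f =1 g.
Proof.
move=> fg t; elim/tensor_ind: t => [a x y Ex Ey||c]; last exact: fg.
- by rewrite !linearP Ex Ey.
- by rewrite !linear0.
Qed.

Lemma pure_tensor_multilinear (V : lmodType K) (I : finType) (c : {ffun I -> V}) i a x y :
  pure_tensor (update c i (a *: x + y)) =
  a *: pure_tensor (update c i x) + pure_tensor (update c i y).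
Proof.
rewrite /pure_tensor -linearP; apply/lproj_eq/lspan_gen.
by exists c, i, a, x, y.
Qed.
End Lifts.

Section TensorAction.
Variables (K : fieldType) (charK : [pchar K] =i pred0).
Variables (V : vectType K) (T : finType).
Implicit Types (x y : galg {perm T}) (t : tensor V T).

Definition tensor_act x t : tensor V T :=
  \sum_g @ratr K (x g : rat) *: tensor_perm g t.

Lemma tensor_act_linear x : linear (tensor_act x).
Proof.
move=> a t u; rewrite /tensor_act scaler_sumr -big_split /=.
by apply: eq_bigr => g _; rewrite linearP scalerDr !scalerA mulrC.
Qed.
HB.instance Definition _ x := GRing.isLinear.Build K (tensor V T) (tensor V T) _
  (tensor_act x) (tensor_act_linear x).

(** Permutations multiply from left to right and [tensor_perm] precomposes; the two reversals cancel
    and leave a left action. *)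
Lemma tensor_permM (g h : {perm T}) t :
  tensor_perm (g * h) t = tensor_perm g (tensor_perm h t).
Proof.
apply: (tensor_ext (f := tensor_perm (g * h))
  (g := tensor_perm g \o tensor_perm h)) t => c /=.
rewrite !tensor_permE; congr pure_tensor; apply/ffunP=> i.
by rewrite !ffunE permM.
Qed.

Lemma tensor_act_sum (I : finType) (F : I -> galg {perm T}) t :
  tensor_act (\sum_i F i) t = \sum_i tensor_act (F i) t.
Proof.
have actD x y : tensor_act (x + y) t = tensor_act x t + tensor_act y t.
  rewrite /tensor_act -big_split /=; apply: eq_bigr => g _.
  by rewrite ffunE ratr_pchar0D // scalerDl.
have act0 : tensor_act 0 t = 0.
  by rewrite /tensor_act big1 // => g _; rewrite ffunE (ratr_nat K 0) scale0r.
by elim/big_rec2: _ => // i _ y _ <-; rewrite actD.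
Qed.

Lemma tensor_act0 t : tensor_act 0 t = 0.
Proof.
by rewrite /tensor_act big1 // => g _; rewrite ffunE (ratr_nat K 0) scale0r.
Qed.

Lemma tensor_actM x y t : tensor_act (x * y) t = tensor_act x (tensor_act y t).
Proof.
rewrite /tensor_act.
transitivity (\sum_h \sum_g @ratr K (x h : rat) * @ratr K (y (h^-1 * g)%g : rat)
    *: tensor_perm g t).
  rewrite exchange_big; apply: eq_bigr => g _ /=; rewrite galgM -scaler_suml.
  congr (_ *: _); elim/big_rec2: _ => [|h a b _ <-]; first exact: (ratr_nat K 0).
  by rewrite ratr_pchar0D // ratr_pchar0M.
apply: eq_bigr => h _; rewrite (reindex_inj (mulgI h)) linear_sum scaler_sumr /=.
by apply: eq_bigr => g _; rewrite mulKg linearZ scalerA tensor_permM.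
Qed.

Lemma tensor_map_perm (f : {linear V -> V}) (g : {perm T}) t :
  tensor_map f (tensor_perm g t) = tensor_perm g (tensor_map f t).
Proof.
apply: (tensor_ext (f := tensor_map f \o tensor_perm g)
  (g := tensor_perm g \o tensor_map f)) t => c /=.
rewrite tensor_permE !tensor_mapE tensor_permE; congr pure_tensor.
by apply/ffunP=> i; rewrite !ffunE.
Qed.

Lemma tensor_map_act (f : {linear V -> V}) x t :
  tensor_map f (tensor_act x t) = tensor_act x (tensor_map f t).
Proof.
rewrite linear_sum; apply: eq_bigr => g _.
by rewrite linearZ /= tensor_map_perm.
Qed.
End TensorAction.

Section Relabel.
Variables (K : fieldType) (V : vectType K) (I J : finType) (b : I -> J) (b' : J -> I).
Hypotheses (bK : cancel b b') (b'K : cancel b' b).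

Lemma relabel_ex : exists f : {linear tensor V J -> tensor V I},
  forall c, f (pure_tensor c) = pure_tensor [ffun i => c (b i)].
Proof.
apply: tensor_lift => c j a x y.
have E z : [ffun i => update c j z (b i)] = update [ffun i => c (b i)] (b' j) z.
  by apply/ffunP=> i; rewrite !ffunE (can2_eq bK b'K).
by rewrite !E pure_tensor_multilinear.
Qed.
End Relabel.

Section YoungRelabel.
Variables (K : fieldType) (charK : [pchar K] =i pred0).
Variables (V : vectType K) (T : finType) (l : seq nat) (r c : T -> nat).
Hypothesis tab : tableau l r c.

Lemma tableau_box : exists (b : T -> box l) (b' : box l -> T),
  [/\ cancel b b', cancel b' b, forall x, box_row (b x) = r x &
      forall x, box_col (b x) = c x].
Proof.
have [inj bd sz] := tab.
have surj (z : box l) : exists x, r x = box_row z /\ c x = box_col z.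
  by apply: tableau_surj tab _; apply: ltn_ord.
have [b' b'P] := fin_all_exists surj.
have b'_inj : injective b'.
  move=> z z' E; have [rz cz] := b'P z; have [rz' cz'] := b'P z'.
  by apply: box_inj; rewrite -?rz -?cz E.
have [b b'K bK] : bijective b' by apply: inj_card_bij; rewrite // card_box sz.
exists b, b'; split=> // x.
  by have [<- _] := b'P (b x); rewrite bK.
by have [_ <-] := b'P (b x); rewrite bK.
Qed.

(** The tableau identifies boxes with T, and S conjugates permutations accordingly, preserving row
    groups, column groups and signs. Antisymmetrizing first and symmetrizing last is the order of
    [row_sum r * col_sum c] under [tensor_actM]. *)
Lemma young_relabel : exists (R : {linear tensor V (box l) -> tensor V T})
    (R' : {linear tensor V T -> tensor V (box l)}),
  [/\ cancel R R', cancel R' R,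
      forall t, R (young_symmetrizer t) =
        tensor_act (row_sum r * col_sum c) (R t) &
      (forall (f : {linear V -> V}) t, R (tensor_map f t) = tensor_map f (R t)) /\
      (forall (f : {linear V -> V}) t, R' (tensor_map f t) = tensor_map f (R' t))].
Proof.
have [b [b' [bK b'K rE cE]]] := tableau_box.
have [R RE] := relabel_ex V bK b'K; have [R' RE'] := relabel_ex V b'K bK.
have mapR (f : {linear V -> V}) t : R (tensor_map f t) = tensor_map f (R t).
  apply: (tensor_ext (f := R \o tensor_map f) (g := tensor_map f \o R)) t => d /=.
  rewrite RE !tensor_mapE RE; congr pure_tensor.
  by apply/ffunP=> i; rewrite !ffunE.
have mapR' (f : {linear V -> V}) t : R' (tensor_map f t) = tensor_map f (R' t).
  apply: (tensor_ext (f := R' \o tensor_map f) (g := tensor_map f \o R')) t => d /=.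
  rewrite RE' !tensor_mapE RE'; congr pure_tensor.
  by apply/ffunP=> i; rewrite !ffunE.
exists R, R'; split=> //.
- apply: (tensor_ext (f := R' \o R) (g := idfun)) => d /=.
  by rewrite RE RE'; congr pure_tensor; apply/ffunP=> i; rewrite !ffunE b'K.
- apply: (tensor_ext (f := R \o R') (g := idfun)) => d /=.
  by rewrite RE' RE; congr pure_tensor; apply/ffunP=> i; rewrite !ffunE bK.
have s_inj (s : {perm box l}) : injective (fun x => b' (s (b x))).
  by move=> x y /(can_inj b'K)/perm_inj/(can_inj bK).
pose S s := perm (s_inj s).
have s'_inj (s : {perm T}) : injective (fun x => b (s (b' x))).
  by move=> x y /(can_inj bK)/perm_inj/(can_inj b'K).
pose S' s := perm (s'_inj s).
have SK : cancel S S' by move=> s; apply/permP=> x; rewrite !permE /= !b'K.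
have S'K : cancel S' S by move=> s; apply/permP=> x; rewrite !permE /= !bK.
have RS s t : R (tensor_perm s t) = tensor_perm (S s) (R t).
  apply: (tensor_ext (f := R \o tensor_perm s) (g := tensor_perm (S s) \o R)) t => d /=.
  rewrite tensor_permE !RE tensor_permE; congr pure_tensor.
  by apply/ffunP=> i; rewrite !ffunE permE b'K.
have S_row s : (S s \in fun_stab r) = Defs.row_perm s.
  apply/fun_stabP/forallP => [H z|H x].
    by have := H (b' z); rewrite permE -!rE !b'K => ->.
  by rewrite permE -!rE b'K; apply/eqP.
have S_col s : (S s \in fun_stab c) = Defs.col_perm s.
  apply/fun_stabP/forallP => [H z|H x].
    by have := H (b' z); rewrite permE -!cE !b'K => ->.
  by rewrite permE -!cE b'K; apply/eqP.
have S_odd s : odd_perm (S s) = odd_perm s.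
  apply: (odd_perm_extension (can_inj b'K)) => [z|x]; first by rewrite permE b'K.
  by rewrite -[x]bK codom_f.
have bijS : bijective S by exists S'.
move=> t; rewrite tensor_actM // /tensor_act linear_sum (reindex S) /=; last first.
  exact: onW_bij.
rewrite [RHS](bigID (@Defs.row_perm l)) /= [X in _ + X]big1 ?addr0; last first.
  by move=> s /negbTE sr; rewrite ffunE S_row sr mul0r (ratr_nat K 0) scale0r.
apply: eq_bigr => s sr; rewrite ffunE S_row sr expr0 mulr1 (ratr_nat K 1) scale1r.
rewrite RS; congr tensor_perm; rewrite linear_sum (reindex S) /=; last first.
  exact: onW_bij.
rewrite [RHS](bigID (@Defs.col_perm l)) /= [X in _ + X]big1 ?addr0; last first.
  by move=> u /negbTE uc; rewrite ffunE S_col uc mul0r (ratr_nat K 0) scale0r.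
apply: eq_bigr => u uc; rewrite ffunE S_col uc mul1r S_odd ratr_sign linearZ /=.
by rewrite RS.
Qed.
End YoungRelabel.

(** * From identities in the group algebra to an isomorphism of representations *)

Section DirectSumIso.
Variables (K : fieldType) (G : groupType) (M : lmodType K) (L : finType).
Variables (A : L -> repMod K G) (B : repMod K G).
Variables (e : {linear M -> M}) (x y c : L -> {linear M -> M}).
Variables (im : forall l, {linear M -> A l}) (inc : forall l, {linear A l -> M}).
Variables (Phi : {linear B -> M}) (Psi : {linear M -> B}) (N : K).
Variable actM : G -> M -> M.
Hypothesis exyce : forall t, \sum_l e (x l (c l (y l (e t)))) = e t.
Hypothesis cyexc : forall l m t,
  c l (y l (e (x m (c m t)))) = if l == m then c l t else 0.
Hypothesis inc_im : forall l t, inc l (im l t) = c l t.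
Hypothesis inc_inj : forall l, injective (inc l).
Hypothesis im_surj : forall l a, exists t, a = im l t.
Hypothesis N_neq0 : N != 0.
Hypothesis PhiPsi : forall t, Phi (Psi t) = e t.
Hypothesis PsiPhi : forall b, Psi (Phi b) = N *: b.
Hypothesis Phi_act : forall g b, Phi (rep_act g b) = actM g (Phi b).
Hypothesis im_act : forall l g t, im l (y l (actM g t)) = rep_act g (im l (y l t)).

(** The map b to (y_l (Phi b))_l, cut down to the image of each c_l, has the inverse f to Psi (sum
    of x_l f_l). Orthogonality of the c_l y_l e x_m c_m gives one composite, the expansion of e the
    other. *)
Lemma rep_iso_dsum : rep_iso B (\repsum_(l : L) A l).
Proof.
pose phi b : dsum A := [ffun l => im l (y l (Phi b))].
pose psi (f : dsum A) : B := Psi (\sum_l x l (inc l (f l))).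
have phiL : linear phi.
  by move=> a b b'; apply/ffunP=> l; rewrite !ffunE !linearP.
have [F FE] := linear_packed phiL.
exists F; split; last first.
  by move=> g b; rewrite !FE; apply/ffunP=> l; rewrite !ffunE Phi_act im_act.
exists psi => [b|f]; rewrite FE.
  pose W t := \sum_l x l (c l (y l t)).
  have psiE : psi (phi b) = Psi (W (Phi b)).
    by congr (Psi _); apply: eq_bigr => l _; rewrite ffunE inc_im.
  (* The factor N squared pays for inserting e on both sides of W, which completes the expansion of
     e. *)
  apply: (scalerI N_neq0); apply: (scalerI N_neq0).
  have WZ a t : W (a *: t) = a *: W t.
    by rewrite scaler_sumr; apply: eq_bigr => l _; rewrite !linearZ.
  have E : Psi (e (W (e (Phi b)))) = N *: (N *: Psi (W (Phi b))).
    by rewrite -[e (Phi b)]PhiPsi PsiPhi -PhiPsi PsiPhi linearZ WZ linearZ.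
  by rewrite psiE -E linear_sum exyce -PhiPsi !PsiPhi.
apply/ffunP=> l; rewrite ffunE; apply: inc_inj.
rewrite inc_im PhiPsi !linear_sum (bigD1 l) //= big1 ?addr0 => [|m ml].
  by have [t ->] := im_surj (f l); rewrite inc_im cyexc eqxx.
have [t ->] := im_surj (f m).
by rewrite inc_im cyexc eq_sym (negbTE ml).
Qed.
End DirectSumIso.

Section Assembly.
Variables (K : fieldType) (charK : [pchar K] =i pred0) (V : vectType K).
Variables (S T : finType) (iota : {perm T}) (eta : S -> T).
Hypothesis iotaK : forall x, iota (iota x) = x.
Hypothesis eta_inj : injective eta.
Hypothesis etaP : forall x, (iota x == x) = (x \in codom eta).
Variables (L : finType) (shape : L -> seq nat).
Hypothesis shape_inj : injective shape.
Hypothesis shapeP : forall l,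
  [/\ is_partition (shape l), sumn (shape l) = #|T| & count odd (shape l) = #|S|].
Hypothesis shape_ex : forall p,
  is_partition p -> sumn p = #|T| -> count odd p = #|S| -> exists l, p = shape l.
Variables (B : repMod K (GL V)).
Variables (Phi : {linear B -> tensor V T}) (Psi : {linear tensor V T -> B}) (N : K).
Hypothesis N_neq0 : N != 0.
Hypothesis PhiPsi : forall t, Phi (Psi t) = tensor_act (fix_sum iota eta) t.
Hypothesis PsiPhi : forall b, Psi (Phi b) = N *: b.
Hypothesis Phi_act : forall g b, Phi (rep_act g b) = tensor_map g (Phi b).

Lemma schur_factor (l : seq nat) (r c : T -> nat) : tableau l r c ->
  exists (im : {linear tensor V T -> schur_rep l V})
         (inc : {linear schur_rep l V -> tensor V T}),
  [/\ forall t, inc (im t) = tensor_act (row_sum r * col_sum c) t,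
      injective inc, forall a, exists t, a = im t &
      forall g t, im (tensor_map (GL_val g) t) = rep_act g (im t)].
Proof.
move=> tab; have [R [R' [RK RK' Ry [_ Rm']]]] := young_relabel charK V tab.
have yP t : young_image (young_symmetrizer (R' t)) by apply/asboolP; exists (R' t).
have imL : linear (fun t => MkSchur (yP t)).
  by move=> a t u; apply: val_inj; rewrite /= !linearP.
have incL : linear (fun a : schur l V => R (schur_val a)).
  by move=> a t u; rewrite linearP.
have [im imE] := linear_packed imL; have [inc incE] := linear_packed incL.
exists im, inc; split=> [t|a b|[a aP]|g t].
- by rewrite incE imE Ry RK'.
- by rewrite !incE => /(can_inj RK)/val_inj.
- have /asboolP[u uE] := aP; exists (R u); rewrite imE; apply: val_inj.
  by rewrite /= RK.
by rewrite !imE; apply: val_inj; rewrite /= Rm' young_symmetrizer_map.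
Qed.

Lemma rep_iso_fix_sum : rep_iso B (\repsum_(l : L) schur_rep (shape l) V).
Proof.
have [r [c [X [Y [tab XY YX]]]]] :=
  fix_sum_decomposition iotaK eta_inj etaP shape_inj shapeP shape_ex.
have [im imP] := fin_all_exists (fun l => schur_factor (tab l)).
have [inc incP] := fin_all_exists imP.
pose e := fix_sum iota eta; pose cc l := row_sum (r l) * col_sum (c l).
have XYt (t : tensor V T) : \sum_l tensor_act e (tensor_act (X l) (tensor_act (cc l)
    (tensor_act (Y l) (tensor_act e t)))) = tensor_act e t.
  transitivity (tensor_act (\sum_l e * X l * cc l * Y l * e) t); last by rewrite XY.
  rewrite (tensor_act_sum charK); apply: eq_bigr => l _.
  by rewrite !(tensor_actM charK).
have YXt l m (t : tensor V T) : tensor_act (cc l) (tensor_act (Y l) (tensor_act e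
    (tensor_act (X m) (tensor_act (cc m) t)))) =
    if l == m then tensor_act (cc l) t else 0.
  transitivity (tensor_act (cc l * Y l * e * X m * cc m) t).
    by rewrite !(tensor_actM charK).
  by rewrite /cc /e YX; case: (l == m); rewrite ?tensor_act0.
apply: (@rep_iso_dsum _ _ _ _ _ _ (tensor_act e)
  (fun l => tensor_act (X l)) (fun l => tensor_act (Y l))
  (fun l => tensor_act (cc l)) im inc Phi Psi N (fun g => tensor_map (GL_val g))
  XYt YXt _ _ _ N_neq0 PhiPsi PsiPhi Phi_act).
- by move=> l; case: (incP l).
- by move=> l; case: (incP l).
- by move=> l; case: (incP l).
by move=> l g t; have [_ _ _ H] := incP l; rewrite -H tensor_map_act.
Qed.
End Assembly.

(** * Jacobi diagrams with at most one trivalent vertex *)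

Section SumPerm.
Variables (S U : finType).

Definition sum_map (s : {perm S}) (g : {perm U}) (h : S + U) : S + U :=
  match h with inl a => inl (s a) | inr u => inr (g u) end.

Lemma sum_map_inj s g : injective (sum_map s g).
Proof. by case=> [a|u] [b|v] //= [] /perm_inj ->. Qed.

Definition sum_perm s g : {perm (S + U)%type} := perm (@sum_map_inj s g).

Lemma sum_permE s g h : sum_perm s g h = sum_map s g h.
Proof. exact: permE. Qed.

Lemma sum_permM s t g h : (sum_perm s g * sum_perm t h = sum_perm (s * t) (g * h))%g.
Proof. by apply/permP=> -[a|u]; rewrite !(permM, sum_permE) /= permM. Qed.

Lemma sum_perm1 : sum_perm 1 1 = 1%g.
Proof. by apply/permP=> -[a|u]; rewrite sum_permE /= !perm1. Qed.

Lemma sum_perm_tperm a b :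
  sum_perm (tperm a b) 1 = tperm (inl a) (inl b) :> {perm (S + U)%type}.
Proof.
apply/permP=> -[c|u]; rewrite sum_permE /=; last first.
  by rewrite perm1 tpermD.
have inl_inj : injective (@inl S U) by move=> x y [].
by rewrite -(inj_tperm _ _ _ inl_inj).
Qed.

Lemma conj_perm_eqP (X : finType) (D D' p : {perm X}) :
  reflect (forall h, p (D h) = D' (p h)) (D ^ p == D')%g.
Proof.
apply: (iffP eqP) => [<- h|E]; first by rewrite permJ.
by apply/permP=> h; rewrite -[h](permKV p) permJ E.
Qed.
End SumPerm.

Section Ord3.

Lemma ord3_cases (P : 'I_3 -> Prop) :
  P ord0 -> P (inord 1) -> P (inord 2) -> forall i, P i.
Proof.
move=> P0 P1 P2 [[|[|[|k]]] k3] //.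
- by rewrite (_ : Ordinal k3 = ord0) //; apply: val_inj.
- by rewrite (_ : Ordinal k3 = inord 1) //; apply: val_inj; rewrite /= inordK.
by rewrite (_ : Ordinal k3 = inord 2) //; apply: val_inj; rewrite /= inordK.
Qed.

Lemma ordS_ord3 : [/\ ordS (ord0 : 'I_3) = inord 1,
  ordS (inord 1 : 'I_3) = inord 2 & ordS (inord 2 : 'I_3) = ord0].
Proof. by split; apply: val_inj; rewrite /= ?inordK. Qed.

Lemma ord3_neq : [/\ (ord0 : 'I_3) != inord 1, (ord0 : 'I_3) != inord 2 &
  (inord 1 : 'I_3) != inord 2].
Proof. by split; rewrite -val_eqE /= ?inordK. Qed.

Lemma ord3_involution_fix (f : 'I_3 -> 'I_3) : involutive f -> exists i, f i = i.
Proof.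
move=> fK; have [n01 n02 n12] := ord3_neq.
have fE i j : f i = j -> f j = i by move=> <-.
move Ea: (f ord0) => a; elim/ord3_cases: a Ea => Ea; first by exists ord0.
  move Ec: (f (inord 2)) => c; elim/ord3_cases: c Ec => Ec; last by exists (inord 2).
    by have := fE _ _ Ec; rewrite Ea => E; rewrite E eqxx in n12.
  by have := fE _ _ Ec; rewrite (fE _ _ Ea) => E; rewrite E eqxx in n02.
move Eb: (f (inord 1)) => b; elim/ord3_cases: b Eb => Eb; [|by exists (inord 1)|].
  by have := fE _ _ Eb; rewrite Ea => E; rewrite E eqxx in n12.
by have := fE _ _ Eb; rewrite (fE _ _ Ea) => E; rewrite E eqxx in n01.
Qed.
End Ord3.

Section JacobiConj.
Variables (T U : finType) (T_le1 : forall v w : T, v = w).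
Variables (K : fieldType) (V : vectType K).
Local Notation S := (T * 'I_3)%type.
Local Notation H := (half_edge T U).
Implicit Types (D : jacobi T U) (s : {perm S}) (g : {perm U}).

Definition matching (e : {perm H}) := forall h, e h != h /\ e (e h) = h.

Lemma connect_rot (e : rel H) v i j :
  (forall w k, e (inl (w, k)) (inl (w, ordS k))) ->
  connect e (inl (v, i)) (inl (v, j)).
Proof.
move=> eS; have [o1 o2 o0] := ordS_ord3.
have c01 : connect e (inl (v, ord0)) (inl (v, inord 1)).
  by rewrite -o1; apply: connect1.
have c12 : connect e (inl (v, inord 1)) (inl (v, inord 2)).
  by rewrite -o2; apply: connect1.
have c20 : connect e (inl (v, inord 2)) (inl (v, ord0)).
  by rewrite -o0; apply: connect1.
have c02 := connect_trans c01 c12; have c10 := connect_trans c12 c20.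
have c21 := connect_trans c20 c01.
by elim/ord3_cases: i; elim/ord3_cases: j => //; apply: connect0.
Qed.

(** Three slots cannot be paired among themselves, so the trivalent vertex is joined to a leg and
    the component condition is automatic. *)
Lemma matching_jacobi (e : {perm H}) : matching e -> is_jacobi e.
Proof.
move=> eP; apply/andP; split.
  by apply/forallP=> h; have [-> ->] := eP h; rewrite eqxx.
apply/forallP=> -[[v i]|u]; apply/existsP; last by exists u; apply: connect0.
have [[j [u ju]]|nj] := pselect (exists j u, e (inl (v, j)) = inr u).
  exists u; apply: connect_trans (connect_rot v i j _) (connect1 _).
    by move=> w k; rewrite /= eqxx.
  by rewrite ju eqxx orbT.
pose f j := if e (inl (v, j)) is inl (_, k) then k else j.
have fE j : e (inl (v, j)) = inl (v, f j).
  rewrite /f; case E : (e _) => [[w k]|u]; first by rewrite (T_le1 w v).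
  by case: nj; exists j, u.
have [j fj] : exists j, f j = j.
  apply: ord3_involution_fix => j; have [_] := eP (inl (v, j)).
  by rewrite !fE => -[].
by have [] := eP (inl (v, j)); rewrite fE fj eqxx.
Qed.

Lemma jacobi_matching D : matching D.
Proof.
by case: D => e /= /andP[/forallP eP _] h; have /andP[-> /eqP ->] := eP h.
Qed.

Lemma conj_matching (e p : {perm H}) : matching e -> matching (e ^ p)%g.
Proof.
move=> eP h; rewrite -[h](permKV p) !permJ (inj_eq perm_inj).
by have [-> ->] := eP (p^-1%g h).
Qed.

Definition conj_jacobi D (p : {perm H}) : jacobi T U :=
  Jacobi (matching_jacobi (conj_matching p (jacobi_matching D))).

Lemma jacobi_class_iso D D' (c c' : {ffun U -> V}) s g :
  edge D' = (edge D ^ sum_perm s g)%g ->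
  (forall v i, s (v, ordS i) = ((s (v, i)).1, ordS (s (v, i)).2)) ->
  (forall u, c' (g u) = c u) ->
  jacobi_class (@Colored T U K V D c) = jacobi_class (Colored D' c').
Proof.
move=> DD' sS cc'; apply/lproj_eq/lspan_gen.
apply: (JacobiIso (p := sum_perm s g)); split.
- case=> [[v i]|u]; rewrite !sum_permE //= sS.
  by case: (s (v, i)).
- by move=> h; rewrite /= DD' permJ.
by move=> u u'; rewrite sum_permE /= => -[<-]; rewrite cc'.
Qed.

(* AS gives this for the transposition of the slots 1 and 2, and invariance   *)
(* under isomorphism gives it for rotations; these generate.                  *)
Definition slot_sign s := forall D D' (c : {ffun U -> V}),
  edge D' = (edge D ^ sum_perm s 1)%g ->
  jacobi_class (Colored D' c) = (-1) ^+ odd_perm s *: jacobi_class (Colored D c).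

Lemma slot_signM s t : slot_sign s -> slot_sign t -> slot_sign (s * t).
Proof.
move=> sP tP D D' c E.
have E1 : edge (conj_jacobi D (sum_perm s 1)) = (edge D ^ sum_perm s 1)%g by [].
rewrite (tP (conj_jacobi D (sum_perm s 1)) D' c); last first.
  by rewrite /= -conjgM sum_permM mulg1.
by rewrite (sP _ _ c E1) scalerA odd_permM signr_addb mulrC.
Qed.

Lemma slot_sign1 : slot_sign 1.
Proof.
move=> D D' c; rewrite sum_perm1 conjg1 odd_perm1 expr0 scale1r => E.
by congr (jacobi_class (Colored _ c)); apply: val_inj.
Qed.

Definition rot_map (a : S) : S := (a.1, ordS a.2).
Lemma rot_map_inj : injective rot_map.
Proof.
move=> [v i] [w j] E; have /= -> := congr1 fst E.
by have /(can_inj (@ordSK _)) /= -> := congr1 snd E.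
Qed.
Definition slot_rot : {perm S} := perm rot_map_inj.

Lemma slot_rotE v i : slot_rot (v, i) = (v, ordS i).
Proof. exact: permE. Qed.

Lemma slot_rot3 : (slot_rot * slot_rot * slot_rot = 1)%g.
Proof.
have [o1 o2 o0] := ordS_ord3.
apply/permP=> -[v i]; rewrite !permM perm1 !slot_rotE; congr pair.
by elim/ord3_cases: i; rewrite ?o1 ?o2 ?o0 ?o1 ?o2.
Qed.

Lemma odd_slot_rot : odd_perm slot_rot = false.
Proof.
by have := congr1 (@odd_perm _) slot_rot3; rewrite !odd_permM odd_perm1; case: odd_perm.
Qed.

Lemma slot_sign_rot : slot_sign slot_rot.
Proof.
move=> D D' c E; rewrite odd_slot_rot expr0 scale1r; apply/esym.
by apply: jacobi_class_iso E _ _ => [v i|u]; rewrite ?slot_rotE ?perm1.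
Qed.

Lemma slot_sign_flip v : slot_sign (tperm (v, inord 1) (v, inord 2)).
Proof.
have [_ _ n12] := ord3_neq.
move=> D D' c E; have -> : odd_perm (tperm (v, inord 1 : 'I_3) (v, inord 2 : 'I_3)).
  rewrite odd_tperm; apply: contra n12 => /eqP[] E12.
  by rewrite E12.
rewrite expr1 scaleN1r; apply/eqP; rewrite -addr_eq0 -linearD /= addrC.
apply/eqP; rewrite -[RHS](linear0 (lproj (@jacobi_rel T U K V))).
apply/lproj_eq; rewrite subr0; apply: lspan_gen.
by apply: (@JacobiAS _ _ _ _ v); rewrite E sum_perm_tperm.
Qed.

Lemma slot_sign_tperm a b : slot_sign (tperm a b).
Proof.
have [o1 o2 o0] := ordS_ord3.
case: a b => v i [w j]; rewrite (T_le1 w v) {w}.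
have rotV : slot_sign slot_rot^-1.
  have -> : (slot_rot^-1 = slot_rot * slot_rot)%g.
    by apply: (mulgI slot_rot); rewrite mulgV mulgA slot_rot3.
  exact: slot_signM slot_sign_rot slot_sign_rot.
have step k k' : slot_sign (tperm (v, k) (v, k')) ->
    slot_sign (tperm (v, ordS k) (v, ordS k')).
  move=> kk; rewrite -!slot_rotE -tpermJ /conjg.
  exact: slot_signM rotV (slot_signM kk slot_sign_rot).
have s12 := @slot_sign_flip v.
have s20 : slot_sign (tperm (v, inord 2) (v, ord0)) by rewrite -o2 -o0; apply: step.
have s01 : slot_sign (tperm (v, ord0) (v, inord 1)) by rewrite -o1 -{1}o0; apply: step.
have tC k k' : slot_sign (tperm (v, k) (v, k')) -> slot_sign (tperm (v, k') (v, k)).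
  by rewrite tpermC.
by elim/ord3_cases: i; elim/ord3_cases: j; rewrite ?tperm1;
  solve [exact: slot_sign1 | assumption | exact: tC].
Qed.

Lemma slot_sign_perm s : slot_sign s.
Proof.
have [ts -> _] := prod_tpermP s.
elim/big_rec: _ => [|t p _]; first exact: slot_sign1.
exact: slot_signM (@slot_sign_tperm _ _).
Qed.

Lemma jacobi_class_conj D D' (c : {ffun U -> V}) s g :
  edge D' = (edge D ^ sum_perm s g)%g ->
  jacobi_class (Colored D [ffun u => c (g u)]) =
  (-1) ^+ odd_perm s *: jacobi_class (Colored D' c).
Proof.
move=> E; pose D1 := conj_jacobi D (sum_perm 1 g).
have -> : jacobi_class (Colored D [ffun u => c (g u)]) = jacobi_class (Colored D1 c).
  by apply: (@jacobi_class_iso _ _ _ _ 1 g) => // [v i|u]; rewrite ?perm1 ?ffunE.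
rewrite (@slot_sign_perm s D1 D' c) ?scalerA -?signr_addb ?addbb ?scale1r //.
by rewrite E /= -conjgM sum_permM mul1g mulg1.
Qed.
End JacobiConj.

Lemma eq_opp_pchar0 (K : fieldType) (M : lmodType K) (x : M) :
  [pchar K] =i pred0 -> x = - x -> x = 0.
Proof.
move=> charK xN; apply/eqP; have : x *+ 2 == 0 by rewrite mulr2n {1}xN addNr.
by rewrite -scaler_nat scaler_eq0 ((pcharf0P K).1 charK).
Qed.

Lemma jacobi_ext (T U : finType) (K : fieldType) (V : vectType K) (M : lmodType K)
    (f g : {linear jacobi_space T U V -> M}) :
  (forall D c, f (jacobi_class (Colored D c)) = g (jacobi_class (Colored D c))) ->
  f =1 g.
Proof.
move=> fg; elim/jacobi_ind => [a x y Ex Ey||[D c]]; last exact: fg.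
- by rewrite !linearP Ex Ey.
- by rewrite !linear0.
Qed.

Section StandardDiagram.
Variables (T U : finType) (T_le1 : forall v w : T, v = w).
Variables (K : fieldType) (charK : [pchar K] =i pred0) (V : vectType K).
Local Notation S := (T * 'I_3)%type.
Local Notation H := (half_edge T U).
Variables (iota : {perm U}) (eta : S -> U).
Hypothesis iotaK : forall x, iota (iota x) = x.
Hypothesis eta_inj : injective eta.
Hypothesis etaP : forall x, (iota x == x) = (x \in codom eta).
Implicit Types (D : jacobi T U) (s : {perm S}) (g : {perm U}).

(* The edges join a to eta a and u to iota u for u outside the image of eta.  *)
Definition std_map (h : H) : H :=
  match h with
  | inl a => inr (eta a)
  | inr u => if [pick a | eta a == u] is Some a then inl a else inr (iota u)
  end.

Lemma std_map_eta a : std_map (inr (eta a)) = inl a.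
Proof.
rewrite /std_map; case: pickP => [b /eqP/eta_inj -> //|/(_ a)].
by rewrite eqxx.
Qed.

Lemma std_mapN u : u \notin codom eta -> std_map (inr u) = inr (iota u).
Proof.
rewrite /std_map => uN; case: pickP => [b /eqP E|//].
by rewrite -E codom_f in uN.
Qed.

Lemma iota_codom u : (iota u \in codom eta) = (u \in codom eta).
Proof. by rewrite -!etaP (inj_eq perm_inj). Qed.

Lemma std_mapK : involutive std_map.
Proof.
move=> [a|u]; first exact: std_map_eta.
have [/codomP[a ->]|uN] := boolP (u \in codom eta); first by rewrite std_map_eta.
by rewrite !std_mapN ?iota_codom // iotaK.
Qed.

Definition std_perm : {perm H} := perm (inv_inj std_mapK).

Lemma std_matching : matching std_perm.
Proof.
move=> h; rewrite !permE std_mapK; split=> //; case: h => [a|u] //.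
have [/codomP[a ->]|uN] := boolP (u \in codom eta); first by rewrite std_map_eta.
rewrite std_mapN //; apply: contra uN => /eqP[] ui.
by rewrite -etaP ui.
Qed.

Definition std_jacobi : jacobi T U := Jacobi (matching_jacobi T_le1 std_matching).

Lemma std_inl a : std_perm (inl a) = inr (eta a).
Proof. by rewrite permE. Qed.

Lemma std_eta a : std_perm (inr (eta a)) = inl a.
Proof. by rewrite permE std_map_eta. Qed.

Lemma std_inr u : u \notin codom eta -> std_perm (inr u) = inr (iota u).
Proof. by move=> uN; rewrite permE std_mapN. Qed.

(** This is where the centralizer of iota enters: up to cyclic orders, its elements are the
    automorphisms of the standard diagram, with s the induced permutation of the slots. *)
Lemma std_conj_compatible s g :
  (std_perm ^ sum_perm s g == std_perm)%g = compatible iota eta s g.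
Proof.
apply/conj_perm_eqP/compatibleP => [E|[gi ge] [a|u]].
- have gE a : g (eta a) = eta (s a).
    by have := E (inl a); rewrite std_inl !sum_permE /= std_inl => -[].
  split=> // u; have [/codomP[a ->]|uN] := boolP (u \in codom eta).
    by rewrite gE !(iota_eta etaP) gE.
  have := E (inr u); rewrite std_inr // !sum_permE /=.
  have [/codomP[a ga]|gN] := boolP (g u \in codom eta); first by rewrite ga std_eta.
  by rewrite std_inr // => -[].
- by rewrite std_inl !sum_permE /= std_inl ge.
have [/codomP[a ->]|uN] := boolP (u \in codom eta).
  by rewrite std_eta !sum_permE /= ge std_eta.
rewrite std_inr // !sum_permE /= std_inr ?gi //.
by rewrite -etaP -gi (inj_eq perm_inj) etaP.
Qed.

Definition std_isos D : {set {perm S} * {perm U}} :=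
  [set p | (std_perm ^ sum_perm p.1 p.2 == edge D)%g].

(** Sums over all identifications of the standard diagram with D that may ignore the cyclic order;
    the sign makes up for this and enforces AS. *)
Definition jacobi_sum D t : tensor V U :=
  \sum_(p in std_isos D) (-1) ^+ odd_perm p.1 *: tensor_perm p.2 t.

Lemma jacobi_sum_linear D : linear (jacobi_sum D).
Proof.
move=> a x y; rewrite scaler_sumr -big_split /=; apply: eq_bigr => p _.
by rewrite linearP scalerDr !scalerA mulrC.
Qed.

Lemma jacobi_sum_map (f : {linear V -> V}) D t :
  tensor_map f (jacobi_sum D t) = jacobi_sum D (tensor_map f t).
Proof.
rewrite linear_sum; apply: eq_bigr => p _.
by rewrite linearZ /= tensor_map_perm.
Qed.

Lemma mem_std_isosM D D' s g p : edge D' = (edge D ^ sum_perm s g)%g ->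
  (((p.1 * s)%g, (p.2 * g)%g) \in std_isos D') = (p \in std_isos D).
Proof.
by move=> E; rewrite !inE /= E -sum_permM conjgM (inj_eq (conjg_inj _)).
Qed.

Let shift_bij s g : bijective (fun p : {perm S} * {perm U} => ((p.1 * s)%g, (p.2 * g)%g)).
Proof.
exists (fun p => ((p.1 * s^-1)%g, (p.2 * g^-1)%g)) => -[p q] /=.
  by rewrite !mulgK.
by rewrite !mulgKV.
Qed.

Lemma jacobi_sum_conj D D' (c c' : {ffun U -> V}) s g :
  edge D' = (edge D ^ sum_perm s g)%g -> (forall u, c' (g u) = c u) ->
  jacobi_sum D' (pure_tensor c') =
  (-1) ^+ odd_perm s *: jacobi_sum D (pure_tensor c).
Proof.
move=> E cc'; rewrite /jacobi_sum scaler_sumr.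
rewrite (reindex _ (onW_bij _ (shift_bij s g))) /=.
apply: eq_big => [p|p _]; first exact: mem_std_isosM.
rewrite odd_permM signr_addb mulrC scalerA; congr (_ *: _).
rewrite !tensor_permE; congr pure_tensor; apply/ffunP=> u.
by rewrite !ffunE permM cc'.
Qed.

Lemma card_std_isos_conj D D' s g : edge D' = (edge D ^ sum_perm s g)%g ->
  #|std_isos D'| = #|std_isos D|.
Proof.
move=> E; rewrite -!sum1_card (reindex _ (onW_bij _ (shift_bij s g))) /=.
by apply: eq_bigl => p; apply: mem_std_isosM.
Qed.

(** The legs are the fixed points of [next], and commuting with [next] leaves only rotations of the
    slots, which are even. *)
Lemma commute_next_sum_perm (p : {perm H}) :
  (forall h, p (Defs.next h) = Defs.next (p h)) ->
  exists s g, p = sum_perm s g /\ odd_perm s = false.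
Proof.
move=> pN.
have next_inr (h : H) : Defs.next h = h -> exists u, h = inr u.
  case: h => [[v i]|u] //=; last by exists u.
  case=> /eqP; rewrite -val_eqE /=.
  by case: i => -[|[|[|]]].
have /fin_all_exists[f fE] u : exists u', p (inr u) = inr u'.
  by apply: next_inr; rewrite -pN.
have f_inj : injective f.
  by move=> u u' E; have := fE u; rewrite E -fE => /perm_inj[].
have /fin_all_exists[k kE] a : exists b, p (inl a) = inl b.
  case pa: (p (inl a)) => [b|u]; first by exists b.
  have [f' fK' f'K] : bijective f by apply: injF_bij.
  by have := fE (f' u); rewrite f'K -pa => /perm_inj.
have k_inj : injective k.
  by move=> a b E; have := kE a; rewrite E -kE => /perm_inj[].
exists (perm k_inj), (perm f_inj); split.
  by apply/permP=> -[a|u]; rewrite sum_permE /= permE ?kE ?fE.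
have kS v i : k (v, ordS i) = slot_rot T (k (v, i)).
  have := pN (inl (v, i)); rewrite /= !kE /=; case: (k (v, i)) => w j.
  by rewrite slot_rotE => -[].
have [v0 _|T0] := pickP T; last first.
  rewrite (_ : perm k_inj = 1%g) ?odd_perm1 //; apply/permP => -[v i].
  by have := T0 v.
have [o1 o2 o0] := ordS_ord3.
have kv : exists n, k (v0, ord0) = (slot_rot T ^+ n)%g (v0, ord0).
  case: (k _) => w j; rewrite (T_le1 w v0).
  elim/ord3_cases: j; [exists 0%N|exists 1%N|exists 2%N].
  - by rewrite expg0 perm1.
  - by rewrite expg1 slot_rotE o1.
  by rewrite expgS expg1 permM !slot_rotE o1 o2.
have [n kn] := kv.
have -> : perm k_inj = (slot_rot T ^+ n)%g.
  have comm a : (slot_rot T ^+ n)%g (slot_rot T a) = slot_rot T ((slot_rot T ^+ n)%g a).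
    by rewrite -!permM -expgS -expgSr.
  apply/permP => -[w i]; rewrite permE (T_le1 w v0).
  have k1 : k (v0, inord 1) = (slot_rot T ^+ n)%g (v0, inord 1).
    by rewrite -o1 kS kn -slot_rotE comm.
  have k2 : k (v0, inord 2) = (slot_rot T ^+ n)%g (v0, inord 2).
    by rewrite -o2 kS k1 -slot_rotE comm.
  by elim/ord3_cases: i.
elim: (n) => [|m IHm]; first by rewrite expg0 odd_perm1.
by rewrite expgS odd_permM IHm odd_slot_rot.
Qed.

(** IHX would require two distinct trivalent vertices, so multilinearity, isomorphisms and AS are
    what must be respected. *)
Lemma jacobi_Phi_ex : exists Phi : {linear jacobi_space T U V -> tensor V U},
  forall D c, Phi (jacobi_class (Colored D c)) = jacobi_sum D (pure_tensor c).
Proof.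
pose h (D : colored_jacobi T U V) := jacobi_sum (diagram D) (pure_tensor (color D)).
have [|Phi PhiE] := @lquot_lift _ _ _ (@jacobi_rel T U K V) (free_lift h).
  move=> _ [D r [c [i [a [x [y ->]]]]]|p D D' [pN pE pC]|v D D' c DD'|v w D D' D'' c vw].
  - rewrite /= free_lift_rel /h /= pure_tensor_multilinear.
    by rewrite jacobi_sum_linear subrr.
  - rewrite /= free_liftUB /h; have [s [g [pE' os]]] := commute_next_sum_perm pN.
    rewrite (@jacobi_sum_conj D D' (color D) (color D') s g).
    + by rewrite os expr0 scale1r subrr.
    + by apply/esym/eqP; apply/conj_perm_eqP => h'; rewrite -pE'.
    by move=> u; apply: pC; rewrite pE' sum_permE.
  - rewrite /= free_liftUD /h /=.
    rewrite (@jacobi_sum_conj D D' c c (tperm (v, inord 1) (v, inord 2)) 1).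
    + rewrite odd_tperm; have [_ _ n12] := ord3_neq.
      rewrite (_ : (_ != _)) ?expr1 ?scaleN1r ?subrr //.
      by apply: contra n12 => /eqP[] ->.
    + by rewrite DD' sum_perm_tperm.
    by move=> u; rewrite perm1.
  by rewrite (T_le1 v w) eqxx in vw.
by exists Phi => D c; rewrite PhiE /= free_liftU.
Qed.

Lemma jacobi_Psi_ex : exists Psi : {linear tensor V U -> jacobi_space T U V},
  forall c, Psi (pure_tensor c) = jacobi_class (Colored std_jacobi c).
Proof.
apply: tensor_lift => c i a x y; rewrite /jacobi_class -linearP.
apply/lproj_eq/lspan_gen; apply: (JacobiMultilinear (D := std_jacobi)).
by exists c, i, a, x, y.
Qed.

(** Each g in the centralizer has exactly one compatible s, so the sum over pairs collapses to
    [fix_sum]. *)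
Lemma jacobi_sum_std t : jacobi_sum std_jacobi t = tensor_act (fix_sum iota eta) t.
Proof.
rewrite /jacobi_sum big_mkcond.
transitivity (\sum_s \sum_g (if (s, g) \in std_isos std_jacobi then
   (-1) ^+ odd_perm s *: tensor_perm g t else 0)).
  by rewrite pair_bigA /=; apply: eq_bigr => -[s g].
rewrite exchange_big /=.
apply: eq_bigr => g _; rewrite ffunE.
have [gC|gN] := boolP (g \in 'C[iota]%g).
  have [s sg] := compatible_ex eta_inj etaP gC.
  rewrite (bigD1 s) //= inE /= std_conj_compatible sg big1 ?addr0 => [|s' ss'].
    by rewrite (fix_signE eta_inj sg) mul1r ratr_sign.
  rewrite inE /= std_conj_compatible; case: ifP => // s'g.
  by rewrite (compatible_uniq eta_inj s'g sg) eqxx in ss'.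
rewrite mul0r (ratr_nat K 0) scale0r big1 // => s _.
by rewrite inE /= std_conj_compatible; case: ifP => // /andP[gC]; rewrite gC in gN.
Qed.

(* Exchanging the two ends of a loop edge does not change the diagram.        *)
Lemma jacobi_class_loop D (c : {ffun U -> V}) a b :
  D (inl a) = inl b -> jacobi_class (Colored D c) = 0.
Proof.
move=> Dab; have Dba : D (inl b) = inl a.
  by rewrite -Dab; case: (jacobi_matching D (inl a)).
have ab : a != b.
  by apply: contraTneq isT => ab; case: (jacobi_matching D (inl a)); rewrite Dab ab eqxx.
have E : edge D = (edge D ^ sum_perm (tperm a b) 1)%g.
  apply/esym/eqP/conj_perm_eqP => h; rewrite sum_perm_tperm -Dab.
  have DK x : D (D x) = x by case: (jacobi_matching D x).
  have := congr1 (fun p : {perm H} => p (D h)) (tpermJ (inl a) (D (inl a)) D).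
  by rewrite permJ DK [in X in _ = X -> _]tpermC => ->.
have := slot_sign_perm T_le1 c E; rewrite odd_tperm ab expr1 scaleN1r => cN.
exact: eq_opp_pchar0 charK cN.
Qed.

(** D too induces an involution k of the legs, fixing those attached to slots. It has as many fixed
    points as iota; a conjugation g between the two determines the permutation of the slots. *)
Lemma std_isos_neq0 D : (forall a, exists u, D (inl a) = inr u) ->
  std_isos D != set0.
Proof.
move=> /fin_all_exists[delta dE].
have DK h : D (D h) = h by case: (jacobi_matching D h).
have d_inj : injective delta.
  by move=> a b E; have := dE a; rewrite E -dE => /perm_inj[].
have Dd a : D (inr (delta a)) = inl a by rewrite -dE DK.
pose k u := if D (inr u) is inr u' then u' else u.
have kd a : k (delta a) = delta a by rewrite /k Dd.
have kN u : u \notin codom delta -> D (inr u) = inr (k u).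
  rewrite /k => uN; case E: (D (inr u)) => [a|//].
  by have := dE a; rewrite -E DK => -[ud]; rewrite ud codom_f in uN.
have kC u : (k u == u) = (u \in codom delta).
  apply/eqP/codomP => [ku|[a ->] //]; apply/codomP; apply: contraT => /kN E.
  by have [] := jacobi_matching D (inr u); rewrite E ku eqxx.
have kK : involutive k.
  move=> u; have [/codomP[a ->]|uN] := boolP (u \in codom delta); first by rewrite !kd.
  have := kN _ uN => E; have kuN : k u \notin codom delta.
    by apply/codomP => -[a kua]; have := DK (inr u); rewrite E kua Dd.
  by have := DK (inr u); rewrite E (kN _ kuN) => -[].
pose kp := perm (inv_inj kK).
have [||g gP] := @involution_conj _ iota kp iotaK.
- by move=> u; rewrite !permE kK.
- rewrite (card_iota_fix eta_inj etaP) -(card_codom d_inj).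
  by apply: eq_card => u; rewrite inE permE kC.
have gk u : g (iota u) = k (g u) by rewrite gP permE.
have /fin_all_exists[f fE] a : exists b, g (eta a) = delta b.
  by apply/codomP; rewrite -kC -gk (iota_eta etaP).
have f_inj : injective f.
  by move=> a b E; apply/eta_inj/(@perm_inj _ g); rewrite !fE E.
apply/set0Pn; exists (perm f_inj, g); rewrite inE /=; apply/conj_perm_eqP => -[a|u].
  by rewrite std_inl !sum_permE /= permE fE dE.
have [/codomP[a ->]|uN] := boolP (u \in codom eta).
  by rewrite std_eta !sum_permE /= permE fE Dd.
rewrite std_inr // !sum_permE /= gk kN //.
by rewrite -kC -gk (inj_eq perm_inj) etaP.
Qed.

(** Psi Phi is multiplication by n, the number of automorphisms of the standard diagram up to cyclic
    order: by AS, every term of [jacobi_sum D] goes back to the class of D. *)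
Lemma rep_iso_jacobi (L : finType) (shape : L -> seq nat) :
  injective shape ->
  (forall l, [/\ is_partition (shape l), sumn (shape l) = #|U| &
     count odd (shape l) = #|{: S}|]) ->
  (forall p, is_partition p -> sumn p = #|U| -> count odd p = #|{: S}| ->
     exists l, p = shape l) ->
  rep_iso (jacobi_rep T U V) (\repsum_(l : L) schur_rep (shape l) V).
Proof.
move=> shape_inj shapeP shape_ex.
have [Phi PhiE] := jacobi_Phi_ex; have [Psi PsiE] := jacobi_Psi_ex.
pose n := #|std_isos std_jacobi|.
have n_gt0 : (0 < n)%N.
  apply/card_gt0P; exists (1%g, 1%g).
  by rewrite inE /= sum_perm1 conjg1.
apply: (@rep_iso_fix_sum K charK V _ _ iota eta iotaK eta_inj etaP L shape
  shape_inj shapeP shape_ex (jacobi_rep T U V) Phi Psi n%:R).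
- by rewrite ((pcharf0P K).1 charK) -lt0n.
- apply: (tensor_ext (f := Phi \o Psi) (g := tensor_act (fix_sum iota eta))) => c.
  by rewrite /= PsiE PhiE jacobi_sum_std.
- elim/jacobi_ind => [a x y Ex Ey||[D c]].
  + by rewrite !linearP Ex Ey.
  + by rewrite !linear0.
  rewrite PhiE /jacobi_sum linear_sum.
  (* If D has no identification with the standard diagram, it has a loop edge, and both sides are
     0. *)
  have [D0|/set0Pn[[s g]]] := eqVneq (std_isos D) set0.
    rewrite D0 big_set0.
    have [[a [b Dab]]|nab] := pselect (exists a b, D (inl a) = inl b).
      by rewrite (jacobi_class_loop c Dab) scaler0.
    suff /std_isos_neq0 : forall a, exists u, D (inl a) = inr u by rewrite D0 eqxx.
    move=> a; case E : (D (inl a)) => [b|u]; last by exists u.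
    by case: nab; exists a, b.
  rewrite inE /= => /eqP E.
  rewrite /n -(card_std_isos_conj (D := std_jacobi) (esym E)) -sumr_const scaler_suml.
  apply: eq_bigr => p; rewrite inE => /eqP Ep.
  rewrite linearZ /= tensor_permE PsiE.
  rewrite (jacobi_class_conj T_le1 (D := std_jacobi) c (esym Ep)).
  by rewrite scalerA -signr_addb addbb.
move=> g; apply: (jacobi_ext (f := Phi \o jacobi_map (GL_val g))
  (g := tensor_map (GL_val g) \o Phi)) => D c.
transitivity (jacobi_sum D (pure_tensor (fmap (GL_val g) c))).
  rewrite -PhiE -[Colored D (fmap _ _)]/(recolor (GL_val g) (Colored D c)).
  by rewrite -jacobi_mapE.
by rewrite -tensor_mapE -jacobi_sum_map -PhiE.
Qed.
End StandardDiagram.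

(** * The two families of diagrams *)

Lemma std_involution_ex (S : finType) m : (#|S| <= m)%N -> ~~ odd (m - #|S|) ->
  exists (iota : {perm 'I_m}) (eta : S -> 'I_m),
    [/\ forall x, iota (iota x) = x, injective eta &
        forall x, (iota x == x) = (x \in codom eta)].
Proof.
set f := #|S| => le_fm ev.
(* The first f legs are fixed, and the later ones are paired consecutively. *)
pose k x := if (x < f)%N then x else if odd (x - f) then x.-1 else x.+1.
have k_lt (x : 'I_m) : (k x < m)%N.
  by have := ltn_ord x; rewrite /k; do 2?case: ifP; lia.
have kK x : k (k x) = x.
  by rewrite /k; do 4?case: ifP; lia.
have iK : involutive (fun x : 'I_m => Ordinal (k_lt x)).
  by move=> x; apply: val_inj; rewrite /= kK.
exists (perm (inv_inj iK)), (fun a => widen_ord le_fm (enum_rank a)); split.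
- by move=> x; rewrite !permE iK.
- by move=> a b E; apply/enum_rank_inj/val_inj; apply: (congr1 val E).
move=> x; rewrite permE -val_eqE /=.
have -> : (k x == x :> nat) = (x < f)%N by rewrite /k; do 2?case: ifP; lia.
apply/idP/codomP => [xf|[a ->]]; last exact: (ltn_ord (enum_rank a)).
by exists (enum_val (Ordinal xf)); apply: val_inj; rewrite /= enum_valK.
Qed.

Lemma parts_inj m : injective (@parts m).
Proof.
move=> l l' E; apply/val_inj/val_inj.
exact: (inj_map val_inj E).
Qed.

(** There are 2d - k legs and 3k slots. Their difference 2d - 4k is even, and the bound 2k <= d
    makes it nonnegative, so the standard diagram exists. *)
Lemma rep_iso_jacobi_B (K : fieldType) (V : vectType K) (d k : nat)
    (L : finType) (shape : L -> seq nat) :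
  [pchar K] =i pred0 -> (k <= 1)%N -> (2 * k <= d)%N -> injective shape ->
  (forall l, [/\ is_partition (shape l), sumn (shape l) = (2 * d - k)%N &
     count odd (shape l) = (k * 3)%N]) ->
  (forall p, is_partition p -> sumn p = (2 * d - k)%N -> count odd p = (k * 3)%N ->
     exists l, p = shape l) ->
  rep_iso (jacobi_B V d k) (\repsum_(l : L) schur_rep (shape l) V).
Proof.
move=> charK k1 kd sinj sP sex.
have cS : #|{: 'I_k * 'I_3}| = (k * 3)%N by rewrite card_prod !card_ord.
have [||iota [eta [iK einj eP]]] := @std_involution_ex ('I_k * 'I_3)%type (2 * d - k).
- by rewrite cS; lia.
- by rewrite cS; lia.
have T1 (v w : 'I_k) : v = w.
  by apply: val_inj => /=; have := ltn_ord v; have := ltn_ord w; lia.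
apply: (rep_iso_jacobi T1 charK V iK einj eP sinj); rewrite cS card_ord //.
Qed.

Theorem proposition1p3 (K : fieldType) (charK : [pchar K] =i pred0)
  (n : nat) (n_ge1 : (1 <= n)%N) (V : vectType K) (dimV : \dim {:V} = n) :
  (forall d : nat, (1 <= d)%N ->
     rep_iso (jacobi_B V d 0)
       (\repsum_(l : partition_of d) schur_rep (double_partition l) V)) /\
  (forall d : nat, (2 <= d)%N ->
     rep_iso (jacobi_B V d 1)
       (\repsum_(l : {l : partition_of (2 * d - 1) | three_odd_parts l})
          schur_rep (val l) V)).
Proof.
have partsP m (l : partition_of m) : is_partition l /\ sumn l = m.
  have : is_partition l && (sumn l == m) by apply/partitionP; exists l.
  by case/andP=> lP /eqP.
split=> d d_ge.
  apply: (@rep_iso_jacobi_B K V d 0 _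
    (fun l : partition_of d => double_partition l)) => //.
  - by move=> l l' /(inj_map double_inj)/parts_inj.
  - move=> l; have [/andP[ls lp] lm] := partsP _ l; split.
    + apply/andP; split.
        rewrite sorted_map; apply: sub_sorted ls => a b.
        by rewrite /= leq_double.
      by rewrite all_map; apply: sub_all lp => a /= a0; rewrite double_gt0.
    + rewrite /double_partition -[in RHS]lm subn0.
      by elim: (parts l) => //= a s ->; lia.
    by apply/eqP; rewrite -leqn0 leqNgt -has_count; apply/hasPn => _ /mapP[a _ ->];
      rewrite odd_double.
  move=> p /andP[ps pp] pm p0.
  have ev : {in p, forall a, ~~ odd a}.
    by apply/hasPn; rewrite has_count p0.
  (* All parts are even, so halving them gives the partition of d. *)
  have pE : p = map double (map half p).
    rewrite -map_comp -[LHS]map_id; apply/eq_in_map => a /ev /=.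
    by move=> ea; rewrite halfK (negbTE ea) subn0.
  have sum_double s : sumn (map double s) = (2 * sumn s)%N.
    by elim: s => //= a s ->; lia.
  have [|l lE] := @partitionP d (map half p) _.
    apply/andP; split; last by move: pm; rewrite {1}pE sum_double; lia.
    apply/andP; split.
      by rewrite sorted_map; apply: sub_sorted ps => a b; apply: half_leq.
    rewrite all_map; apply/allP => a ap /=.
    by have := allP pp a ap; have := ev a ap; lia.
  by exists l; rewrite /double_partition -lE.
apply: (@rep_iso_jacobi_B K V d 1 _
  (fun l : {l : partition_of (2 * d - 1) | three_odd_parts l} => parts (val l))) => //.
- by move=> l l' /parts_inj/val_inj.
- by move=> l; have [lP lm] := partsP _ (val l); split=> //; apply/eqP/(valP l).
move=> p pP pm p3.
have [|l lE] := @partitionP (2 * d - 1) p _; first by rewrite pP pm eqxx.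
have l3 : three_odd_parts l by rewrite /three_odd_parts -lE p3.
by exists (exist _ l l3).
Qed.
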